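(* Let $k$ and $\lambda$ be positive integers with $k\geq 2\lambda+2$. Then there exists an integer $v_0$ such that for every integer $v\geq v_0$, every $(v,k,\lambda)$-BIBD $(X,\mathcal{B})$ can be nested into a $(v,k+1,\lambda+1)$-packing; that is, there is a mapping $\phi:\mathcal{B}\to X$ such that $(X,\{B\cup\{\phi(B)\}\mid B\in\mathcal{B}\})$ is a $(v,k+1,\lambda+1)$-packing.
   Context: Let $X$ be a set of $v$ points and $\mathcal{B}$ a (multi)set of $k$-subsets of $X$ (blocks). $(X,\mathcal{B})$ is a $(v,k,\lambda)$-packing if every pair of distinct points of $X$ is contained in at most $\lambda$ blocks, and a $(v,k,\lambda)$-BIBD if every pair of distinct points is contained in exactly $\lambda$ blocks. A mapping $\phi:\mathcal{B}\to X$ as in the claim is called a nesting (in particular $\phi(B)\notin B$ is implicit since the enlarged blocks have size $k+1$). *)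

(* Defs.v *)
From mathcomp Require Import all_boot.

Set Implicit Arguments.
Unset Strict Implicit.
Unset Printing Implicit Defensive.

(* A multiset of blocks on X is a family B : I -> {set X} over a finite index
   type I, so that repeated blocks are distinct indices and are counted with
   multiplicity. *)

Definition pair_degree (X I : finType) (B : I -> {set X}) (x y : X) : nat :=
  #|[set i : I | (x \in B i) && (y \in B i)]|.

Definition is_packing (v k lambda : nat) (X I : finType)
    (B : I -> {set X}) : Prop :=
  [/\ #|X| = v,
      forall i : I, #|B i| = k
    & forall x y : X, x != y -> pair_degree B x y <= lambda].

Definition is_BIBD (v k lambda : nat) (X I : finType)
    (B : I -> {set X}) : Prop :=
  [/\ #|X| = v,
      forall i : I, #|B i| = k
    & forall x y : X, x != y -> pair_degree B x y = lambda].

(* phi i is not required separately to lie outside B i: this follows from the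
   enlarged blocks having size k.+1. *)
Definition is_nesting (v k lambda : nat) (X I : finType)
    (B : I -> {set X}) (phi : I -> X) : Prop :=
  is_packing v k.+1 lambda.+1 (fun i : I => phi i |: B i).

(* Main.v *)
Require Import Defs.
From mathcomp Require Import all_boot all_order all_algebra.
From mathcomp Require Import reals Rstruct.
From mathcomp.analysis Require Import sequences exp.
From mathcomp Require Import lra ring zify.

(** A nesting is a matching covering all blocks in the hypergraph whose vertices
    are the blocks and the pairs of points, and whose edge [(i, x)], for [x]
    outside [B i], consists of the block [i] and the pairs [{x, y}], [y] in [B i].
    Blocks have degree [v - k] and pairs have degree about [2 lambda v / (k - 1)],
    a constant factor below [v], while two vertices share at most [lambda] edges.

    Choose edges one at a time at random among those disjoint from the previous
    ones.  All degrees then follow deterministic trajectories: after [m] steps a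
    vertex keeps its degree up to the factor given by the chance that each of its
    edges survives.  This is derandomised by an exponential potential that sums
    [exp (s (+-(d(z) / D_m(z) - 1) - eps_m))] over the uncovered vertices [z]: a
    uniformly chosen edge hardly increases it on average, so some edge does not.
    When all but a fraction [1 / Q] of the blocks are covered, a constant
    proportion (independent of [Q]) of the colours is still free for every
    remaining block, whereas every point lies in [O(v / Q)] remaining blocks; the
    remaining blocks are then coloured greedily, using no point too often. *)

Set Implicit Arguments.
Unset Strict Implicit.
Unset Printing Implicit Defensive.

Import Order.TTheory GRing.Theory Num.Theory.

(** * Exponential inequalities for the potential argument *)

Section Exponential.
Local Open Scope ring_scope.
Variable R : realType.
Implicit Types x y : R.

(** Multiply by [expR (- x)], which is at least [1 - x]: it is enough that
    [(1 + x + 2 * x ^+ 2) * (1 - x)] is at least 1, which holds for [x <= 1 / 2]. *)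
Lemma expR_le_quadratic x : `|x| <= 1 / 2 -> expR x <= 1 + x + 2 * x ^+ 2.
Proof.
move=> /ler_normlP [h1 h2].
have h := expR_ge1Dx (- x).
have p := expR_gt0 (- x).
have e := expRxMexpNx_1 x.
rewrite -(ler_pM2r p) e.
apply: (@le_trans _ _ ((1 + x + 2 * x ^+ 2) * (1 - x))).
  have -> : (1 + x + 2 * x ^+ 2) * (1 - x) = 1 + x ^+ 2 * (1 - 2 * x) by ring.
  by rewrite lerDl mulr_ge0 ?sqr_ge0 //; lra.
apply: ler_wpM2l h; nra.
Qed.

Lemma expR_sub_le x : 0 <= x -> x <= 1 / 2 -> expR (- (2 * x)) <= 1 - x.
Proof.
move=> x0 x1; rewrite expRN -[leRHS]invrK lef_pV2 ?posrE ?expR_gt0 ?invr_gt0; [|lra|lra].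
apply: le_trans (expR_ge1Dx _).
rewrite -[leLHS]mul1r ler_pdivrMr; [nra|lra].
Qed.

Lemma sum_expR_le (T : finType) (H : {set T}) (f : T -> R) (q : R) :
  (forall e, e \in H -> `|f e| <= 1 / 2) ->
  \sum_(e in H) f e <= 0 ->
  \sum_(e in H) f e ^+ 2 <= #|H|%:R * q ->
  \sum_(e in H) expR (f e) <= #|H|%:R * (1 + 2 * q).
Proof.
move=> hf h1 h2.
apply: (@le_trans _ _ (\sum_(e in H) (1 + f e + 2 * f e ^+ 2))).
  by apply: ler_sum => e /hf; apply: expR_le_quadratic.
rewrite !big_split /= -mulr_sumr sumr_const.
lra.
Qed.

(* One random step seen from a vertex of degree [d] and ideal degree [D]:
   choosing [e] destroys [dec e] of its edges, while the ideal degree shrinks by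
   the factor [1 - sigma].  The slack [eta] absorbs the drift of [d / D], so only
   the quadratic term of the exponential survives. *)
Lemma vertex_step (T : finType) (H : {set T}) (dec : T -> R)
    (d D sigma tau eta eps Cd s q theta : R) :
  0 < D -> 0 <= d -> d <= 2 * D -> 0 <= sigma -> sigma <= 1 / 2 ->
  0 <= tau -> 0 <= s -> 0 <= eta ->
  (theta = 1 \/ theta = -1) ->
  (forall e, e \in H -> 0 <= dec e /\ dec e <= Cd) ->
  `|\sum_(e in H) dec e - #|H|%:R * (sigma * d)| <= #|H|%:R * (tau * d) ->
  4 * tau <= eta ->
  s * (4 * sigma + 2 * (Cd / D) + eta) <= 1 / 2 ->
  s ^+ 2 * (64 * sigma ^+ 2 + 32 * (Cd * (sigma + tau) / D) + 2 * eta ^+ 2) <= q ->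
  \sum_(e in H) expR (s * (theta * ((d - dec e) / (D * (1 - sigma)) - 1) - (eps + eta)))
  <= #|H|%:R * (1 + 2 * q) * expR (s * (theta * (d / D - 1) - eps)).
Proof.
move=> D0 d0 dD s0 s1 t0 ss0 e0 th hdec hsum h4 hsm hq.
set N := #|H|%:R : R.
have N0 : 0 <= N by rewrite /N.
have sg : 0 < 1 - sigma by lra.
have Dn : D != 0 by lra.
have th2 : theta ^+ 2 = 1 by case: th => ->; rewrite ?sqrrN expr1n.
have nth : `|theta| = 1 by case: th => ->; rewrite ?normrN normr1.
pose Y := d / D.
have Y0 : 0 <= Y by rewrite /Y divr_ge0 // ltW.
have Y2 : Y <= 2 by rewrite /Y ler_pdivrMr.
pose a e := dec e / D.
have a0 e : e \in H -> 0 <= a e by move=> /hdec [h _]; rewrite /a divr_ge0 // ltW.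
have aC e : e \in H -> a e <= Cd / D.
  by move=> /hdec [_ h]; rewrite /a ler_wpM2r // invr_ge0 ltW.
pose w := (1 - sigma)^-1.
have w0 : 0 < w by rewrite /w invr_gt0.
have w2 : w <= 2.
  by rewrite /w -[leRHS]invrK lef_pV2 ?posrE //; [lra | rewrite invr_gt0; lra].
(* The change of the relative degree [d / D] when [e] is chosen; the shrinking of [D] cancels its
   mean up to an error governed by [tau]. *)
pose Dl e := (Y * sigma - a e) * w.
pose f e := s * (theta * Dl e - eta).
have step e : expR (s * (theta * ((d - dec e) / (D * (1 - sigma)) - 1) - (eps + eta)))
   = expR (s * (theta * (d / D - 1) - eps)) * expR (f e).
  rewrite -expRD; congr expR; rewrite /f /Dl /a /w /Y; field.
  by rewrite Dn; lra.
have -> : \sum_(e in H) expR (s * (theta * ((d - dec e) / (D * (1 - sigma)) - 1) - (eps + eta)))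
  = expR (s * (theta * (d / D - 1) - eps)) * \sum_(e in H) expR (f e).
  by rewrite mulr_sumr; apply: eq_bigr => e _; rewrite step.
rewrite mulrC ler_wpM2r ?(ltW (expR_gt0 _)) //.
have Ys : 0 <= Y * sigma by rewrite mulr_ge0.
have Ys2 : Y * sigma <= 2 * sigma by rewrite ler_wpM2r.
have Dl_le e : e \in H -> `|Dl e| <= 4 * sigma + 2 * (Cd / D).
  move=> eH; have h1 := a0 _ eH; have h2 := aC _ eH.
  rewrite /Dl normrM (gtr0_norm w0).
  apply: (@le_trans _ _ ((2 * sigma + Cd / D) * 2)); last by lra.
  apply: ler_pM => //; first by rewrite ltW.
  by rewrite ler_norml; apply/andP; split; lra.
have sumD : \sum_(e in H) Dl e = (N * (sigma * d) - \sum_(e in H) dec e) * (w / D).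
  rewrite /Dl -mulr_suml sumrB sumr_const -[_ *+ _]mulr_natl -/N /a -mulr_suml /Y.
  by field.
apply: sum_expR_le.
- move=> e eH; rewrite /f normrM (ger0_norm ss0).
  apply: le_trans hsm; apply: ler_wpM2l => //.
  apply: le_trans (ler_normB _ _) _.
  by rewrite normrM nth mul1r (ger0_norm e0) lerD2r Dl_le.
- rewrite /f -mulr_sumr; apply: mulr_ge0_le0 => //.
  rewrite sumrB -mulr_sumr sumr_const -[eta *+ _]mulr_natl -/N subr_le0.
  apply: le_trans (ler_norm _) _; rewrite normrM nth mul1r sumD normrM distrC.
  have wD : 0 <= w / D by rewrite divr_ge0 // ltW.
  rewrite (ger0_norm wD).
  apply: (@le_trans _ _ (N * (tau * d) * (w / D))); first by apply: ler_wpM2r.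
  have -> : N * (tau * d) * (w / D) = N * (tau * (Y * w)) by rewrite /Y; field.
  apply: ler_wpM2l => //; apply: le_trans h4; rewrite [leRHS]mulrC.
  apply: ler_wpM2l => //; have -> : 4 = 2 * 2 :> R by ring.
  by apply: ler_pM => //; rewrite ltW.
- have sumdec : \sum_(e in H) dec e <= N * (sigma * d) + N * (tau * d).
    by move: hsum; rewrite ler_distl => /andP [_].
  have Cd0 e : e \in H -> 0 <= Cd by move=> /hdec [? ?]; lra.
  (* Only one factor of [a e ^+ 2] is replaced by its maximum [Cd / D]; the other is kept, since its
     mean is at most [2 * (sigma + tau)]. Replacing both would be too weak for the quadratic number
     of steps made later. *)
  have sq e : e \in H -> f e ^+ 2 <= s ^+ 2 * (64 * sigma ^+ 2 + 16 * (Cd / D) * a e + 2 * eta ^+ 2).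
    move=> eH; rewrite /f exprMn ler_wpM2l ?sqr_ge0 //.
    have h1 := a0 _ eH; have h2 := aC _ eH.
    have E1 : (theta * Dl e - eta) ^+ 2 <= 2 * Dl e ^+ 2 + 2 * eta ^+ 2.
      have : 0 <= (theta * Dl e + eta) ^+ 2 by apply: sqr_ge0.
      have -> : (theta * Dl e + eta) ^+ 2 = theta ^+ 2 * Dl e ^+ 2 + 2 * theta * Dl e * eta + eta ^+ 2 by ring.
      have -> : (theta * Dl e - eta) ^+ 2 = theta ^+ 2 * Dl e ^+ 2 - 2 * theta * Dl e * eta + eta ^+ 2 by ring.
      rewrite th2; lra.
    have E2 : Dl e ^+ 2 <= 4 * (Y * sigma - a e) ^+ 2.
      rewrite /Dl exprMn mulrC; apply: ler_wpM2r; first exact: sqr_ge0.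
      have -> : 4 = 2 ^+ 2 :> R by ring.
      by rewrite lerXn2r // nnegrE // ltW.
    have E3 : (Y * sigma - a e) ^+ 2 <= 2 * (Y * sigma) ^+ 2 + 2 * a e ^+ 2.
      by have := sqr_ge0 (Y * sigma + a e); rewrite -subr_ge0 => h; rewrite -subr_ge0; nra.
    have E4 : (Y * sigma) ^+ 2 <= 4 * sigma ^+ 2.
      have -> : 4 * sigma ^+ 2 = (2 * sigma) ^+ 2 by ring.
      by rewrite lerXn2r // nnegrE; lra.
    have E5 : a e ^+ 2 <= Cd / D * a e by rewrite expr2 ler_wpM2r.
    lra.
  apply: le_trans (ler_sum _ sq) _.
  have -> : \sum_(e in H) s ^+ 2 * (64 * sigma ^+ 2 + 16 * (Cd / D) * a e + 2 * eta ^+ 2)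
    = s ^+ 2 * (N * (64 * sigma ^+ 2) + 16 * (Cd / D) * \sum_(e in H) a e + N * (2 * eta ^+ 2)).
    rewrite -mulr_sumr 2!big_split /= 2!sumr_const -mulr_sumr /N.
    by rewrite [#|H|%:R * (64 * _)]mulr_natl [#|H|%:R * (2 * _)]mulr_natl.
  apply: (@le_trans _ _ (N * (s ^+ 2 * (64 * sigma ^+ 2 + 32 * (Cd * (sigma + tau) / D) + 2 * eta ^+ 2))));
    last by apply: ler_wpM2l.
  rewrite [leRHS]mulrCA; apply: ler_wpM2l; first exact: sqr_ge0.
  rewrite !mulrDr !lerD2r !lerD2l.
  case: (set_0Vmem H) => [H0|[e eH]].
    by rewrite H0 big_set0 /N H0 cards0 !mul0r mulr0.
  have C0 := Cd0 _ eH.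
  have CD0 : 0 <= Cd / D by rewrite divr_ge0 // ltW.
  rewrite /a -mulr_suml.
  have : (\sum_(i in H) dec i) / D <= N * ((sigma + tau) * 2).
    rewrite ler_pdivrMr //; apply: le_trans sumdec _.
    have -> : N * (sigma * d) + N * (tau * d) = N * (sigma + tau) * d by ring.
    have -> : N * ((sigma + tau) * 2) * D = N * (sigma + tau) * (2 * D) by ring.
    by apply: ler_wpM2l => //; rewrite mulr_ge0 //; lra.
  move=> h; apply: le_trans (ler_wpM2l (_ : 0 <= 16 * (Cd / D)) h) _; first by lra.
  by rewrite le_eqVlt; apply/orP; left; apply/eqP; field.
Qed.

End Exponential.

(** * Degrees, codegrees and lost edges in a hypergraph *)

Section Hypergraph.
Variables (V E : finType) (ed : E -> {set V}).
Implicit Types (H M : {set E}) (S U : {set V}) (e f : E) (y z : V).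

Definition deg H z := #|[set e in H | z \in ed e]|.
Definition codeg H y z := #|[set e in H | (y \in ed e) && (z \in ed e)]|.
Definition meets H S := #|[set e in H | ~~ [disjoint S & ed e]]|.
Definition survivors H S := [set f in H | [disjoint ed f & S]].
(** For [e] avoiding [z] this is the drop of the degree of [z] when [e] is chosen. Removing [z] from
    [ed f] keeps the count small for [e] through [z] too, so that it can be summed over all of
    [H]. *)
Definition loss H z e := #|[set f in H | (z \in ed f) && ~~ [disjoint ed f :\ z & ed e]]|.

Lemma deg_survivors H z e : z \notin ed e ->
  deg H z = deg (survivors H (ed e)) z + loss H z e.
Proof.
move=> ze; rewrite /deg /loss -(cardsID [set f | [disjoint ed f & ed e]]).
congr (_ + _); apply: eq_card => f; rewrite !inE.
  by rewrite -andbA (andbC (z \in _)) andbA.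
rewrite andbC -andbA; congr (_ && (_ && ~~ _)).
rewrite -!setI_eq0 setIDAC; congr (_ == _).
apply/setP => y; rewrite !inE; case: eqP => [->|//].
by rewrite (negbTE ze) andbF.
Qed.

Lemma sum_deg H S : \sum_(q in S) deg H q = \sum_(e in H) #|S :&: ed e|.
Proof.
rewrite (eq_bigr (fun q => \sum_(e in H) (q \in ed e : nat))); last first.
  move=> q _; rewrite /deg -sum1_card -big_mkcondr /=.
  by apply: eq_bigl => e; rewrite !inE.
rewrite exchange_big /=; apply: eq_bigr => e _.
rewrite -big_mkcondr -sum1_card /=.
by apply: eq_bigl => q; rewrite !inE.
Qed.

Lemma meetsE H S : meets H S = \sum_(e in H) (~~ [disjoint S & ed e] : nat).
Proof.
rewrite /meets -sum1_card -big_mkcondr /=.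
by apply: eq_bigl => e; rewrite !inE.
Qed.

Lemma meets_le H S : meets H S <= \sum_(q in S) deg H q.
Proof.
rewrite sum_deg meetsE; apply: leq_sum => e _.
by case: (boolP [disjoint _ & _]) => //; rewrite -setI_eq0 -card_gt0.
Qed.

Lemma sum_codeg H S z : \sum_(q in S) codeg H z q =
  \sum_(e in H) (z \in ed e) * #|S :&: ed e|.
Proof.
have -> : \sum_(q in S) codeg H z q = \sum_(q in S) deg [set e in H | z \in ed e] q.
  apply: eq_bigr => q _; apply: eq_card => e.
  by rewrite !inE andbA.
rewrite sum_deg; under eq_bigl do rewrite inE.
rewrite big_mkcondr /=; apply: eq_bigr => e _.
by case: (z \in _); rewrite ?mul1n ?mul0n.
Qed.

(** A Bonferroni inequality: an edge with [t > 0] vertices in [S] is counted [t - 1] times too often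
    on the left. Fix one of these vertices; its pairs with the others pay for the excess, and the
    codegree bound limits all such pairs. *)
Lemma meets_ge H S L :
  (forall y z, y != z -> codeg H y z <= L) ->
  \sum_(q in S) deg H q <= meets H S + #|S| * #|S| * L.
Proof.
move=> hL.
have h1 : \sum_(q in S) \sum_(q' in S :\ q) codeg H q q' <= #|S| * #|S| * L.
  rewrite -mulnA -sum_nat_const; apply: leq_sum => q qS.
  apply: (@leq_trans (\sum_(q' in S :\ q) L)).
    apply: leq_sum => q'; rewrite !inE => /andP [h _].
    by apply: hL; rewrite eq_sym.
  by rewrite sum_nat_const leq_mul2r subset_leq_card ?orbT // subD1set.
apply: leq_trans (leq_add (leqnn _) h1).
rewrite sum_deg meetsE.
under [X in _ <= _ + X]eq_bigr do rewrite sum_codeg.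
rewrite [X in _ <= _ + X]exchange_big /= -big_split /=.
apply: leq_sum => e _.
case: (set_0Vmem (S :&: ed e)) => [->|[q]]; first by rewrite cards0.
rewrite inE => /andP [qS qe].
have -> : [disjoint S & ed e] = false.
  by apply/negbTE; rewrite -setI_eq0; apply/set0Pn; exists q; rewrite inE qS.
rewrite (bigD1 q) //= qe mul1n (cardsD1 q) inE qS qe /=.
rewrite leq_add2l; apply: leq_trans (leq_addr _ _).
by apply: subset_leq_card; apply/subsetP => x; rewrite !inE => /andP [-> /andP [-> ->]].
Qed.

(** A lost edge contains [z] and some vertex of [e] other than [z]; each such vertex accounts for at
    most [L] edges. *)
Lemma loss_le H z e L :
  (forall y z, y != z -> codeg H y z <= L) -> loss H z e <= #|ed e| * L.
Proof.
move=> hL; pose Hz := [set f in H | z \in ed f].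
have -> : loss H z e = meets Hz (ed e :\ z).
  apply: eq_card => f; rewrite !inE -andbA.
  congr (_ && (_ && ~~ _)); rewrite -!setI_eq0; congr (_ == _).
  by apply/setP => x; rewrite !inE; case: (x != z); case: (x \in ed e); case: (x \in ed f).
apply: leq_trans (meets_le _ _) _.
apply: (@leq_trans (\sum_(q in ed e :\ z) L)).
  apply: leq_sum => q; rewrite !inE => /andP [h _].
  apply: leq_trans (hL z q _); last by rewrite eq_sym.
  by apply: subset_leq_card; apply/subsetP => f; rewrite !inE -andbA.
by rewrite sum_nat_const leq_mul2r subset_leq_card ?orbT // subD1set.
Qed.

Lemma sum_loss H z :
  \sum_(e in H) loss H z e = \sum_(f in H | z \in ed f) meets H (ed f :\ z).
Proof.
rewrite (eq_bigr (fun e => \sum_(f in H | z \in ed f) (~~ [disjoint ed f :\ z & ed e] : nat))); last first.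
  move=> e _; rewrite /loss -sum1_card -big_mkcondr /=.
  by apply: eq_bigl => f; rewrite !inE andbA.
by rewrite exchange_big /=; apply: eq_bigr => f _; rewrite meetsE.
Qed.

End Hypergraph.

(** * One step of the greedy choice, by averaging the potential *)

Section GreedyStep.
Local Open Scope ring_scope.
Variables (R : realType) (V E : finType) (ed : E -> {set V}).
Variables (col : V -> bool) (kappa : bool -> nat).
Implicit Types (H M : {set E}) (S U : {set V}) (e f : E) (y z : V).

Definition class U c := [set z in U | col z == c].

Definition potential (s : R) (D : bool -> R) (eps : R) H U : R :=
  \sum_(z in U)
    (expR (s * (1 * ((deg ed H z)%:R / D (col z) - 1) - eps)) +
     expR (s * (-1 * ((deg ed H z)%:R / D (col z) - 1) - eps))).

(* [hit_rate n c] is the chance that a uniformly chosen edge covers a given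
   vertex of class [c] when [n c] such vertices are left and all degrees within
   a class agree; [decay n c] is the chance that it covers one of the other
   vertices of a given edge through that vertex. *)
Definition hit_rate (n : bool -> nat) c : R := (kappa c)%:R / (n c)%:R.
Definition decay (n : bool -> nat) c : R :=
  \sum_(c' : bool) (kappa c')%:R * hit_rate n c' - hit_rate n c.

Definition edge_size : nat := kappa true + kappa false.

Lemma hit_rate_ge0 n c : 0 <= hit_rate n c.
Proof. by rewrite /hit_rate divr_ge0 ?ler0n. Qed.

Lemma decay_ge0 n c : (0 < kappa c)%N -> 0 <= decay n c.
Proof.
move=> kc; rewrite /decay (bigD1 c) //= addrAC.
have := hit_rate_ge0 n c => h.
apply: addr_ge0; last first.
  by apply: sumr_ge0 => c' _; rewrite mulr_ge0 ?ler0n ?hit_rate_ge0.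
by rewrite -[X in _ - X]mul1r -mulrBl mulr_ge0 // subr_ge0 ler1n.
Qed.

Section Step.
Variables (H : {set E}) (U : {set V}) (L : nat) (D : bool -> R) (eps : R).
Hypothesis sub_ed : forall e, e \in H -> ed e \subset U.
Hypothesis card_ed : forall e c, e \in H -> #|class (ed e) c| = kappa c.
Hypothesis codeg_le : forall y z, y != z -> (codeg ed H y z <= L)%N.
Hypothesis kappa_gt0 : forall c, (0 < kappa c)%N.
Let n c := #|class U c|.
Hypothesis n_gt0 : forall c, (0 < n c)%N.
Hypothesis D_gt0 : forall c, 0 < D c.
Hypothesis eps_ge0 : 0 <= eps.
Hypothesis eps_le : eps <= 1 / 4.
Hypothesis near_regular : forall z, z \in U ->
  `|(deg ed H z)%:R / D (col z) - 1| <= eps.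

Lemma card_edge e : e \in H -> #|ed e| = edge_size.
Proof.
move=> eH; rewrite /edge_size -(card_ed true eH) -(card_ed false eH).
rewrite -(cardsID [set z | col z]).
by congr (_ + _)%N; apply: eq_card => z; rewrite !inE;
  case: (col z); rewrite ?andbT ?andbF.
Qed.

Lemma sum_deg_class c : (\sum_(z in class U c) deg ed H z = kappa c * #|H|)%N.
Proof.
rewrite sum_deg (eq_bigr (fun=> kappa c)); first by rewrite sum_nat_const mulnC.
move=> e eH; rewrite -(card_ed c eH); apply: eq_card => z; rewrite !inE; case: (boolP (z \in ed e)) => ze; rewrite ?andbF //=.
by rewrite (subsetP (sub_ed eH)) // andbT.
Qed.

Lemma deg_bounds z : z \in U ->
  (1 - eps) * D (col z) <= (deg ed H z)%:R /\ (deg ed H z)%:R <= (1 + eps) * D (col z).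
Proof.
move=> zU; have D0 := D_gt0 (col z).
have := near_regular zU; rewrite ler_distl => /andP [h1 h2].
by split; [rewrite -ler_pdivlMr | rewrite -ler_pdivrMr].
Qed.

(** The degrees of a class sum to [kappa c * #|H|], and each is within a factor [1 +- eps] of
    [D c]. *)
Lemma card_edges_bounds c :
  (n c)%:R * ((1 - eps) * D c) <= (kappa c)%:R * #|H|%:R /\
  (kappa c)%:R * #|H|%:R <= (n c)%:R * ((1 + eps) * D c).
Proof.
rewrite -natrM -sum_deg_class natr_sum.
have cst (a : R) : (n c)%:R * a = \sum_(z in class U c) a.
  by rewrite sumr_const mulr_natl.
by split; rewrite cst; apply: ler_sum => z; rewrite inE => /andP [zU /eqP <-];
  case: (deg_bounds zU).
Qed.

Lemma edges_gt0 : 0 < #|H|%:R :> R.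
Proof.
have [h _] := card_edges_bounds true.
have k0 : 0 < (kappa true)%:R :> R by rewrite ltr0n.
rewrite -(pmulr_rgt0 _ k0); apply: lt_le_trans h.
apply: mulr_gt0; first by rewrite ltr0n.
by apply: mulr_gt0 => //; have := eps_le; lra.
Qed.

(** Both quantities lie between [(1 - eps) * D (col z)] and [(1 + eps) * D (col z)]; the constant 3
    works because [1 + eps <= (1 + 3 * eps) * (1 - eps)] for [eps <= 1 / 4]. *)
Lemma deg_hit_rate z : z \in U ->
  `|(deg ed H z)%:R - #|H|%:R * hit_rate n (col z)| <=
    3 * eps * (#|H|%:R * hit_rate n (col z)).
Proof.
move=> zU; have [h1 h2] := deg_bounds zU.
have [h3 h4] := card_edges_bounds (col z).
have D0 := D_gt0 (col z).
have n0 : 0 < (n (col z))%:R :> R by rewrite ltr0n.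
set P := #|H|%:R * _.
have h3' : (1 - eps) * D (col z) <= P.
  by rewrite /P /hit_rate mulrA ler_pdivlMr // mulrC [leRHS]mulrC.
have h4' : P <= (1 + eps) * D (col z).
  by rewrite /P /hit_rate mulrA ler_pdivrMr // mulrC [leRHS]mulrC.
have e1 := eps_le; have e2 := eps_ge0; clearbody P; rewrite ler_distl; apply/andP; split; nra.
Qed.

Lemma sum_hit_rate e z : e \in H -> z \in ed e ->
  \sum_(q in ed e :\ z) hit_rate n (col q) = decay n (col z).
Proof.
move=> eH ze; rewrite /decay.
have -> : \sum_(c' : bool) (kappa c')%:R * hit_rate n c' = \sum_(q in ed e) hit_rate n (col q).
  rewrite (partition_big col predT) //=; apply: eq_bigr => c _.
  rewrite -(card_ed c eH) mulr_natl -sumr_const.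
  apply: congr_big => // [q|q]; first by rewrite !inE.
  by rewrite inE => /andP [_ /eqP ->].
by rewrite [in RHS](big_setD1 z) //= addrAC subrr add0r.
Qed.

(** Up to codegrees, the edges meeting [ed f :\ z] are counted by the sum of its degrees. The two
    terms below [tau] are the deviation of these degrees and the overcount. *)
Lemma meets_decay f z (tau : R) : f \in H -> z \in ed f ->
  3 * eps * decay n (col z) + (edge_size ^ 2 * L)%:R / #|H|%:R <= tau ->
  `|(meets ed H (ed f :\ z))%:R - #|H|%:R * decay n (col z)| <= #|H|%:R * tau.
Proof.
move=> fH zf htau; have N0 := edges_gt0.
have e1 : `|(\sum_(q in ed f :\ z) deg ed H q)%:R - #|H|%:R * decay n (col z)|
    <= 3 * eps * (#|H|%:R * decay n (col z)).
  rewrite -(sum_hit_rate fH zf) mulr_sumr natr_sum -sumrB mulr_sumr.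
  apply: le_trans (ler_norm_sum _ _ _) _; apply: ler_sum => q.
  rewrite !inE => /andP [_ qf]; apply: deg_hit_rate.
  by apply: (subsetP (sub_ed fH)).
have e2 := meets_le ed H (ed f :\ z).
have e3 := meets_ge (ed f :\ z) codeg_le.
have e4 : (#|ed f :\ z| * #|ed f :\ z| * L <= edge_size ^ 2 * L)%N.
  rewrite leq_mul2r -mulnn leq_mul ?orbT // -(card_edge fH);
  by rewrite subset_leq_card // subD1set.
have e5 := leq_trans e3 (leq_add (leqnn _) e4).
move: e2 e5; rewrite -(ler_nat R) -(ler_nat R) natrD.
set m := (meets _ _ _)%:R; set S := (\sum_(q in _) _)%:R in e1 *; set C := (_ * L)%:R in htau *.
move: e1; rewrite !ler_distl => /andP [a1 a2] a3 a4.
have : #|H|%:R * (3 * eps * decay n (col z) + C / #|H|%:R) <= #|H|%:R * tau.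
  by rewrite ler_wpM2l // ltW.
rewrite mulrDr (mulrCA _ C) divff ?gt_eqF // mulr1.
rewrite mulrCA => h.
have C0 : 0 <= C by rewrite /C.
by apply/andP; split; lra.
Qed.

Lemma sum_loss_decay z (tau : R) :
  3 * eps * decay n (col z) + (edge_size ^ 2 * L)%:R / #|H|%:R <= tau ->
  `|\sum_(e in H) (loss ed H z e)%:R - #|H|%:R * (decay n (col z) * (deg ed H z)%:R)|
     <= #|H|%:R * (tau * (deg ed H z)%:R).
Proof.
move=> htau; rewrite -natr_sum sum_loss natr_sum.
have degE : (deg ed H z)%:R = \sum_(f in H | z \in ed f) 1 :> R.
  by rewrite /deg -sum1_card natr_sum; apply: eq_bigl => f; rewrite !inE.
have cst (a : R) : #|H|%:R * (a * (deg ed H z)%:R) = \sum_(f in H | z \in ed f) #|H|%:R * a.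
  rewrite degE mulrA mulr_sumr; apply: eq_bigr => f _; exact: mulr1.
rewrite !cst -sumrB; apply: le_trans (ler_norm_sum _ _ _) _.
by apply: ler_sum => f /andP [fH zf]; apply: meets_decay.
Qed.

Lemma greedy_step (s eta q : R) (tau : bool -> R) :
  (forall c, decay n c <= 1 / 2) -> 0 <= s -> 0 <= eta ->
  (forall c, 3 * eps * decay n c + (edge_size ^ 2 * L)%:R / #|H|%:R <= tau c) ->
  (forall c, 4 * tau c <= eta) ->
  (forall c, s * (4 * decay n c + 2 * ((edge_size * L)%:R / D c) + eta) <= 1 / 2) ->
  (forall c, s ^+ 2 * (64 * decay n c ^+ 2
     + 32 * ((edge_size * L)%:R * (decay n c + tau c) / D c) + 2 * eta ^+ 2) <= q) ->
  exists2 e, e \in H &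
    potential s (fun c => D c * (1 - decay n c)) (eps + eta)
      (survivors ed H (ed e)) (U :\: ed e)
    <= (1 + 2 * q) * potential s D eps H U.
Proof.
move=> hdec s0 eta0 htau h4 hs hq; have N0 := edges_gt0.
pose psi e z theta : R := expR (s * (theta *
   (((deg ed H z)%:R - (loss ed H z e)%:R) / (D (col z) * (1 - decay n (col z))) - 1) - (eps + eta))).
(* [F e] also keeps the vertices covered by [e]. Their terms are nonnegative, so [F e] dominates the
   new potential, and its sum over [e] can be bounded vertex by vertex. *)
pose F e : R := \sum_(z in U) (psi e z 1 + psi e z (-1)).
have FP e : e \in H -> potential s (fun c => D c * (1 - decay n c)) (eps + eta)
      (survivors ed H (ed e)) (U :\: ed e) <= F e.
  move=> eH; rewrite /potential /F [leRHS](bigID (fun z => z \in ed e)) /=.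
  rewrite -[leLHS]add0r; apply: lerD.
    by apply: sumr_ge0 => z _; rewrite addr_ge0 // ltW // expR_gt0.
  rewrite le_eqVlt; apply/orP; left; apply/eqP; apply: congr_big => // [z|z].
    by rewrite !inE andbC.
  rewrite !inE => /andP [ze zU]; rewrite /psi.
  by rewrite (deg_survivors H ze) natrD addrK.
have sumF : \sum_(e in H) F e <= #|H|%:R * ((1 + 2 * q) * potential s D eps H U).
  rewrite /F exchange_big /= /potential mulrA mulr_sumr.
  apply: ler_sum => z zU; rewrite big_split /= mulrDr.
  have [d1 d2] := deg_bounds zU; have D0 := D_gt0 (col z).
  have go theta : theta = 1 \/ theta = -1 -> \sum_(e in H) psi e z theta <=
     #|H|%:R * (1 + 2 * q) * expR (s * (theta * ((deg ed H z)%:R / D (col z) - 1) - eps)).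
    move=> th.
    have dc0 : 0 <= decay n (col z) by apply: decay_ge0.
    have t0 : 0 <= tau (col z).
      apply: le_trans (htau (col z)); apply: addr_ge0.
        by rewrite mulr_ge0 //; have := eps_ge0; lra.
      by rewrite divr_ge0.
    apply: (@vertex_step _ _ _ _ _ _ _ (tau (col z)) _ _ ((edge_size * L)%:R)) => //.
    - by apply: le_trans d2 _; rewrite ler_wpM2r ?(ltW D0) //; have := eps_le; lra.
    - move=> e eH; split; first exact: ler0n.
      by rewrite ler_nat -(card_edge eH) loss_le.
    - exact: sum_loss_decay.
  by apply: lerD; apply: go; [left | right].
case: (boolP [exists e in H, F e <= (1 + 2 * q) * potential s D eps H U]).
  move=> /existsP [e /andP [eH hF]]; exists e => //.
  exact: le_trans (FP e eH) hF.
rewrite negb_exists => /forallP hno; exfalso.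
have : \sum_(e in H) ((1 + 2 * q) * potential s D eps H U) < \sum_(e in H) F e.
  have [e0 e0H] : exists e0, e0 \in H.
    by apply/set0Pn; rewrite -card_gt0 -(ltr_nat R).
  apply: ltr_sum; first by apply/hasP; exists e0; rewrite ?mem_index_enum.
  by move=> e eH; have := hno e; rewrite eH /= -ltNge.
by rewrite sumr_const -[ltLHS]mulr_natl ltNge sumF.
Qed.

End Step.
End GreedyStep.

(** * Matchings and the hypergraph they leave uncovered *)

Section Matching.
Variables (V E : finType) (ed : E -> {set V}).
Implicit Types (H M : {set E}) (U : {set V}) (e f : E).

Definition matching H M : Prop :=
  M \subset H /\ {in M &, forall e f, e != f -> [disjoint ed e & ed f]}.

Definition covered M : {set V} := \bigcup_(e in M) ed e.

Definition residual H M := survivors ed H (covered M).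

Lemma covered0 : covered set0 = set0.
Proof. by rewrite /covered big_set0. Qed.

Lemma coveredU1 M e : covered (e |: M) = ed e :|: covered M.
Proof. by rewrite /covered bigcup_setU big_set1. Qed.

Lemma residual0 H : residual H set0 = H.
Proof.
by apply/setP => f; rewrite !inE covered0 -setI_eq0 setI0 eqxx andbT.
Qed.

Lemma residualU1 H M e : residual H (e |: M) = survivors ed (residual H M) (ed e).
Proof.
apply/setP => f; rewrite !inE coveredU1 -andbA; congr (_ && _).
by rewrite -!setI_eq0 setIUr setU_eq0 andbC.
Qed.

Lemma matchingU1 H M e : matching H M -> e \in residual H M -> matching H (e |: M).
Proof.
move=> [sM dM]; rewrite inE => /andP [eH de]; split.
  by rewrite subUset sub1set eH.
have dM1 f : f \in M -> [disjoint ed e & ed f].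
  by move=> fM; apply: disjointWr de; apply: bigcup_sup.
move=> f g; rewrite !inE => /orP [/eqP ->|fM] /orP [/eqP ->|gM].
- by rewrite eqxx.
- by move=> _; apply: dM1.
- by move=> _; rewrite disjoint_sym; apply: dM1.
- exact: dM.
Qed.

Lemma notin_residual H M e : ed e != set0 -> e \in residual H M -> e \notin M.
Proof.
move=> /set0Pn [z ze]; rewrite inE => /andP [_ de]; apply/negP => eM.
have : z \in covered M by apply/bigcupP; exists e.
by rewrite (disjointFr de ze).
Qed.

End Matching.

(** * Iteration of the greedy step *)

Section Process.
Local Open Scope ring_scope.
Variables (R : realType) (V E : finType) (ed : E -> {set V}).
Variables (col : V -> bool) (kappa : bool -> nat).
Variables (H0 : {set E}) (U0 : {set V}) (L : nat).
Hypothesis sub_ed : forall e, e \in H0 -> ed e \subset U0.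
Hypothesis card_ed : forall e c, e \in H0 -> #|class col (ed e) c| = kappa c.
Hypothesis codeg_le : forall y z, y != z -> (codeg ed H0 y z <= L)%N.
Hypothesis kappa_gt0 : forall c, (0 < kappa c)%N.
Implicit Types (M : {set E}).

(** Every edge takes exactly [kappa c] vertices of class [c], so the number left after [m] steps
    does not depend on the edges chosen. *)
Definition remaining m c : nat := (#|class col U0 c| - kappa c * m)%N.

Definition ideal (D0 : bool -> R) (m : nat) (c : bool) : R :=
  D0 c * \prod_(j < m) (1 - decay R kappa (remaining j) c).

Lemma idealS D0 m c : ideal D0 m.+1 c = ideal D0 m c * (1 - decay R kappa (remaining m) c).
Proof. by rewrite /ideal big_ord_recr /= mulrA. Qed.

Lemma card_alive M e c : e \in residual ed H0 M ->
  #|class col (U0 :\: covered ed (e |: M)) c| =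
  (#|class col (U0 :\: covered ed M) c| - kappa c)%N.
Proof.
rewrite inE => /andP [eH de]; rewrite -(card_ed c eH).
have -> : class col (U0 :\: covered ed (e |: M)) c =
    class col (U0 :\: covered ed M) c :\: class col (ed e) c.
  apply/setP => z; rewrite coveredU1 !inE.
  by case: (col z == c); case: (z \in ed e); rewrite ?andbT ?andbF.
rewrite cardsD; congr (_ - #|pred_of_set _|)%N; apply/setIidPr.
apply/subsetP => z; rewrite !inE => /andP [ze ->].
by rewrite (disjointFr de ze) (subsetP (sub_ed eH)).
Qed.

(** A deviation beyond [eps] makes one of the two exponents of [z] nonnegative, and that term alone
    is then at least 1. *)
Lemma potential_lt1 (s eps : R) D H U : 0 <= s ->
  potential ed col s D eps H U < 1 ->
  forall z, z \in U -> `|(deg ed H z)%:R / D (col z) - 1| <= eps.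
Proof.
move=> s0 hP z zU; rewrite leNgt; apply/negP => hz; move: hP.
apply/negP; rewrite -leNgt /potential (bigD1 z) //=.
apply: ler_wpDr.
  by apply: sumr_ge0 => y _; rewrite addr_ge0 // ltW // expR_gt0.
set Y := _ / _ in hz *.
have [h|h] : eps < Y - 1 \/ eps < -1 * (Y - 1).
- by move: hz; rewrite ltr_normr mulN1r => /orP.
- apply: ler_wpDr; first exact: ltW (expR_gt0 _).
  by rewrite -[leLHS]expR0 ler_expR mulr_ge0 // mul1r; lra.
- apply: ler_wpDl; first exact: ltW (expR_gt0 _).
  by rewrite -[leLHS]expR0 ler_expR mulr_ge0 //; lra.
Qed.

(* [T] is the natural time scale: [K0 / T] bounds all decay rates, [G] bounds all
   ideal degrees from below and [NN] the number of remaining edges. *)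
Lemma greedy_matching (D0 : bool -> R) (T K0 K1 G NN eps0 s C1 : R) (m0 : nat) :
  (forall z, z \in U0 -> (deg ed H0 z)%:R = D0 (col z)) ->
  0 < T -> 0 <= K0 -> K1 = 12 * K0 + 1 -> 0 < G -> 0 < NN -> 0 < eps0 -> 0 <= s ->
  (m0%:R <= T) -> K0 / T <= 1 / 2 ->
  (forall m c, (m < m0)%N -> (0 < remaining m c)%N) ->
  (forall m c, (m < m0)%N -> decay R kappa (remaining m) c <= K0 / T) ->
  (forall m c, (m <= m0)%N -> G <= ideal D0 m c) ->
  (forall m, (m < m0)%N -> (kappa true)%:R * NN <= 3 / 4 * ((remaining m true)%:R * G)) ->
  (edge_size kappa ^ 2 * L)%:R / NN <= eps0 / (4 * T) ->
  eps0 * expR K1 <= 1 / 4 ->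
  s * (4 * (K0 / T) + 2 * ((edge_size kappa * L)%:R / G) + K1 / T) <= 1 / 2 ->
  s ^+ 2 * (64 * (K0 / T) ^+ 2 + 32 * ((edge_size kappa * L)%:R * (K0 / T + K1 / T) / G)
     + 2 * (K1 / T) ^+ 2) <= C1 / (2 * T) ->
  #|U0|%:R * (2 * expR (- (s * eps0))) * expR C1 < 1 ->
  exists M, [/\ matching ed H0 M, #|M| = m0 &
    forall z, z \in U0 :\: covered ed M ->
      `|(deg ed (residual ed H0 M) z)%:R / ideal D0 m0 (col z) - 1| <= 1 / 4].
Proof.
move=> hD0 T0 K00 K1E G0 NN0 e00 s0 mT KT hleft hdec hG hNN hC he hs hq hP.
have K10 : 0 < K1 by lra.
(* The slack grows by the factor [1 + K1 / T] per step, so for at most [T] steps it stays below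
   [eps0 * expR K1], hence below [1 / 4]. *)
pose eps m : R := eps0 * (1 + K1 / T) ^+ m.
have r1 : 0 <= K1 / T by rewrite divr_ge0 // ltW.
have eps_ge m : eps0 <= eps m.
  by rewrite /eps ler_peMr ?(ltW e00) // exprn_ege1 // lerDl.
have exp_bd (A : R) m : 0 <= A -> m%:R <= T -> (1 + A / T) ^+ m <= expR A.
  move=> A0 hm.
  apply: (@le_trans _ _ (expR (A / T) ^+ m)).
    rewrite lerXn2r ?expR_ge1Dx // nnegrE ?(ltW (expR_gt0 _)) //.
    by rewrite addr_ge0 // divr_ge0 // ltW.
  rewrite -expRM_natl ler_expR mulrCA ler_piMr // ler_pdivrMr // mul1r.
  exact: hm.
have eps_le m : m%:R <= T -> eps m <= 1 / 4.
  move=> hm; apply: le_trans he; rewrite /eps ler_wpM2l ?(ltW e00) //.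
  by apply: exp_bd => //; apply: ltW.
have T2 : 0 < 2 * T by lra.
have C10 : 0 <= C1 / (2 * T).
  apply: le_trans hq; apply: mulr_ge0; first exact: sqr_ge0.
  apply: addr_ge0; last by rewrite mulr_ge0 ?sqr_ge0.
  apply: addr_ge0; first by rewrite mulr_ge0 ?sqr_ge0.
  rewrite mulr_ge0 // divr_ge0 ?(ltW G0) // mulr_ge0 // -mulrDl divr_ge0 ?(ltW T0) //.
  by rewrite addr_ge0 // ltW.
have C1T : 1 + 2 * (C1 / (2 * T)) = 1 + C1 / T by field; rewrite gt_eqF.
have C10' : 0 <= C1 by move: C10; rewrite ler_pdivlMr // mul0r.
pose Phi m M := potential ed col s (ideal D0 m) (eps m) (residual ed H0 M) (U0 :\: covered ed M).
have Phi0 : Phi 0%N set0 = #|U0|%:R * (2 * expR (- (s * eps0))).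
  rewrite /Phi residual0 covered0 setD0 /potential mulr_natl -sumr_const.
  apply: eq_bigr => z zU.
  have i0 : ideal D0 0 (col z) = D0 (col z) by rewrite /ideal big_ord0 mulr1.
  have D1 : D0 (col z) != 0 by rewrite -i0 gt_eqF // (lt_le_trans G0) // hG.
  rewrite (hD0 _ zU) i0 divff //= subrr !mulr0 /eps expr0 mulr1 sub0r mulrN.
  by rewrite -mulr2n mulr_natl.
(* The potential grows by at most [1 + C1 / T] per step, in total by at most [expR C1], so it stays
   below 1 and all degrees stay near their ideal values. *)
suff main m : (m <= m0)%N -> exists M, [/\ matching ed H0 M, #|M| = m,
    forall c, #|class col (U0 :\: covered ed M) c| = remaining m c &
    Phi m M <= Phi 0%N set0 * (1 + C1 / T) ^+ m].
  have [M [h1 h2 h3 h4]] := main m0 (leqnn _).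
  exists M; split => // z zU; apply: le_trans (eps_le _ mT).
  apply: (potential_lt1 s0 _ zU).
  apply: le_lt_trans h4 _; apply: le_lt_trans hP; rewrite Phi0.
  apply: ler_wpM2l; first by rewrite !mulr_ge0 // ltW // expR_gt0.
  exact: exp_bd.
elim: m => [_|m IH mm0].
  exists set0; split.
  - by split; [exact: sub0set | move=> e f; rewrite inE].
  - exact: cards0.
  - by move=> c; rewrite covered0 setD0 /remaining muln0 subn0.
  - by rewrite expr0 mulr1.
have mT' : m%:R <= T by apply: le_trans mT; rewrite ler_nat ltnW.
have [M [h1 h2 h3 h4]] := IH (ltnW mm0).
have nr z : z \in U0 :\: covered ed M ->
   `|(deg ed (residual ed H0 M) z)%:R / ideal D0 m (col z) - 1| <= eps m.
  apply: (potential_lt1 s0).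
  apply: le_lt_trans h4 _; apply: le_lt_trans hP; rewrite Phi0.
  apply: ler_wpM2l; first by rewrite !mulr_ge0 // ltW // expR_gt0.
  exact: exp_bd.
have resH e : e \in residual ed H0 M -> e \in H0 by rewrite inE => /andP [].
have sub' e : e \in residual ed H0 M -> ed e \subset U0 :\: covered ed M.
  by rewrite inE => /andP [eH de]; rewrite subsetD sub_ed.
have card' e c : e \in residual ed H0 M -> #|class col (ed e) c| = kappa c.
  by move=> /resH; apply: card_ed.
have cod' y z : y != z -> (codeg ed (residual ed H0 M) y z <= L)%N.
  move=> /codeg_le; apply: leq_trans; apply: subset_leq_card.
  by apply/subsetP => e; rewrite !inE -!andbA => /and4P [-> _ -> ->].
have rateE c : hit_rate R kappa (fun c => #|class col (U0 :\: covered ed M) c|) c = hit_rate R kappa (remaining m) c.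
  by rewrite /hit_rate h3.
have decE c : decay R kappa (fun c => #|class col (U0 :\: covered ed M) c|) c = decay R kappa (remaining m) c.
  by rewrite /decay rateE; congr (_ - _); apply: eq_bigr => c' _; rewrite rateE.
have n' c : (0 < #|class col (U0 :\: covered ed M) c|)%N by rewrite h3 hleft.
have Dp c : 0 < ideal D0 m c by apply: lt_le_trans (hG _ _ (ltnW mm0)).
have ep0 : 0 <= eps m by apply: le_trans (ltW e00) (eps_ge m).
have ep1 := eps_le _ mT'.
have dec0 c : 0 <= decay R kappa (remaining m) c by apply: decay_ge0.
have KT0 : 0 <= K0 / T by rewrite divr_ge0 // ltW.
(* The largest value with [4 * tau <= eta]. As [K1 = 12 * K0 + 1], it equals [3 * eps m * (K0 / T)],
   for the degree deviation, plus [eps m / (4 * T)], for the codegrees. *)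
pose tau (c : bool) : R := eps m * (K1 / T) / 4.
have Ng : NN <= #|residual ed H0 M|%:R.
  have [b1 _] := @card_edges_bounds R _ _ _ _ _ _ _ _ _ sub' card' Dp nr true.
  rewrite h3 in b1.
  have k0 : 0 < (kappa true)%:R :> R by rewrite ltr0n.
  rewrite -(ler_pM2l k0); apply: le_trans b1; apply: le_trans (hNN _ mm0) _.
  rewrite mulrCA; apply: ler_wpM2l; first exact: ler0n.
  by apply: ler_pM; rewrite ?(ltW G0) ?hG ?(ltnW mm0) //; lra.
have step := @greedy_step R _ _ _ _ _ _ _ L _ _ sub' card' cod' kappa_gt0 n' Dp ep0 ep1 nr
   s (eps m * (K1 / T)) (C1 / (2 * T)) tau.
have eK : eps m * (K1 / T) <= K1 / T by rewrite ler_piMl //; lra.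
have eK0 : 0 <= eps m * (K1 / T) by rewrite mulr_ge0.
have KL0 : 0 <= (edge_size kappa * L)%:R :> R by [].
have GD c : (ideal D0 m c)^-1 <= G^-1.
  by rewrite lef_pV2 ?posrE // hG // ltnW.
have {step} [|//|//|||||e eH step] := step.
- by move=> c; rewrite decE; apply: le_trans KT; apply: hdec.
- move=> c; rewrite decE /tau.
  have b1 : 3 * eps m * decay R kappa (remaining m) c <= 3 * eps m * (K0 / T).
    by rewrite ler_wpM2l ?hdec // mulr_ge0.
  have b2 : (edge_size kappa ^ 2 * L)%:R / #|residual ed H0 M|%:R <= eps0 / (4 * T).
    apply: le_trans hC; rewrite ler_wpM2l // lef_pV2 ?posrE //.
    exact: lt_le_trans Ng.
  have b3 : eps0 / (4 * T) <= eps m / (4 * T).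
    by rewrite ler_wpM2r ?eps_ge // invr_ge0; lra.
  apply: le_trans (lerD b1 (le_trans b2 b3)) _.
  by rewrite K1E le_eqVlt; apply/orP; left; apply/eqP; field; rewrite gt_eqF.
- by move=> c; rewrite /tau; lra.
- move=> c; rewrite decE; apply: le_trans hs; apply: ler_wpM2l => //.
  apply: lerD => //; apply: lerD; first by rewrite ler_wpM2l ?hdec.
  by rewrite ler_wpM2l // ler_wpM2l.
- move=> c; rewrite decE; apply: le_trans hq; apply: ler_wpM2l; first exact: sqr_ge0.
  apply: lerD.
    apply: lerD.
      by rewrite ler_wpM2l // lerXn2r ?nnegrE ?hdec.
    rewrite ler_wpM2l //.
    have t0 : 0 <= tau c by rewrite /tau; lra.
    apply: ler_pM; rewrite ?invr_ge0 ?(ltW (Dp _)) //.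
      by rewrite mulr_ge0 // addr_ge0.
    rewrite ler_wpM2l // lerD ?hdec // /tau; lra.
  by rewrite ler_wpM2l // lerXn2r ?nnegrE.
exists (e |: M); split.
- exact: matchingU1.
- rewrite cardsU1 h2 (notin_residual _ eH) //.
  rewrite -card_gt0; apply: (@leq_trans #|class col (ed e) true|).
    by rewrite card' // kappa_gt0.
  by apply: subset_leq_card; apply/subsetP => z; rewrite inE => /andP [].
- by move=> c; rewrite card_alive // h3 /remaining mulnS subnDA subnAC.
- rewrite exprS mulrCA; apply: (@le_trans _ _ ((1 + C1 / T) * Phi m M)); last first.
    by rewrite ler_wpM2l // addr_ge0 // divr_ge0 // ltW.
  rewrite C1T in step; apply: le_trans step.
  rewrite /Phi residualU1 coveredU1 setUC -setDDl.
  rewrite le_eqVlt; apply/orP; left; apply/eqP; apply: eq_bigr => z _.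
  by rewrite idealS decE /eps exprS; congr (expR _ + expR _); ring.
Qed.
End Process.

Lemma card_bigcup_le (S T : finType) (P : {set S}) (F : S -> {set T}) (m : nat) :
  (forall i, i \in P -> #|F i| <= m) -> #|\bigcup_(i in P) F i| <= #|P| * m.
Proof.
move=> hF; rewrite -sum_nat_const.
apply: leq_trans (leq_sum _ hF).
elim/big_rec2: _ => [|i a b _ h]; first by rewrite cards0.
by apply: leq_trans (leq_card_setU _ _) _; rewrite leq_add2l.
Qed.

(** * The nesting hypergraph and the greedy completion of a matching *)

Section NestingHypergraph.
Variables (X I : finType) (B : I -> {set X}) (k : nat).
Hypothesis card_B : forall i, #|B i| = k.
Implicit Types (i j : I) (x y : X) (e f : I * X) (M : {set I * X}).

(* The edge [(i, x)] stands for the choice [phi i = x]: it occupies the block [i]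
   and the [k] pairs that [x] forms with the points of [B i]. *)
Definition star e : {set I + {set X}} :=
  locked (inl e.1 |: [set inr [set e.2; y] | y in B e.1]).
Definition is_block (z : I + {set X}) : bool := if z is inl _ then true else false.
Definition star_kappa (c : bool) : nat := if c then 1 else k.
Definition stars : {set I * X} := [set e | e.2 \notin B e.1].
(** The right summand contains all subsets of [X]; only those of size 2 stand for unordered pairs
    and count as vertices. *)
Definition is_cell (z : I + {set X}) : bool := if z is inr p then #|p| == 2 else true.
Definition cells : {set I + {set X}} := [set z | is_cell z].

Lemma inl_star i e : (inl i \in star e) = (i == e.1).
Proof.
rewrite /star -lock !inE; apply/orP/eqP => [[/eqP [->] //|]|->]; last by left.
by case/imsetP.
Qed.

Lemma inr_starP p e : reflect (exists2 y, y \in B e.1 & p = [set e.2; y]) (inr p \in star e).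
Proof.
rewrite /star -lock !inE /=; apply: (iffP imsetP) => [[y yB [->]]|[y yB ->]]; by exists y.
Qed.

Lemma eq_set2 x y a b : x != y -> [set x; y] = [set a; b] ->
  (x = a /\ y = b) \/ (x = b /\ y = a).
Proof.
move=> xy E.
have : x \in [set a; b] by rewrite -E !inE eqxx.
have : y \in [set a; b] by rewrite -E !inE eqxx orbT.
rewrite !inE => /orP [/eqP Ey|/eqP Ey] /orP [/eqP Ex|/eqP Ex].
- by rewrite Ex Ey eqxx in xy.
- by right.
- by left.
- by rewrite Ex Ey eqxx in xy.
Qed.

Lemma card_star e c : e \in stars -> #|class is_block (star e) c| = star_kappa c.
Proof.
rewrite inE => eB; case: c => /=.
  rewrite -(cards1 (inl e.1 : I + {set X})); apply: eq_card => -[i|p].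
    by rewrite [LHS]inE inl_star andbT [RHS]inE.
  by rewrite !inE /= andbF.
rewrite -(card_B e.1) -(card_in_imset (f := fun y => inr [set e.2; y] : I + {set X}) (D := mem (B e.1))).
  apply: eq_card => -[i|p].
    rewrite !inE /= andbF; apply/esym/negbTE/negP.
    by case/imsetP.
  by rewrite !inE /= andbT /star -lock !inE.
move=> y w yB wB [E].
have ney : e.2 != y by apply: contraNneq eB => ->.
by case: (eq_set2 ney E) => [[_ ->] //|[ew _]]; rewrite ew wB in eB.
Qed.

Lemma star_pair x y e : x != y -> e \in stars ->
  (inr [set x; y] \in star e) =
  ((e.2 == x) && (y \in B e.1)) || ((e.2 == y) && (x \in B e.1)).
Proof.
move=> xy; rewrite inE => eB; apply/inr_starP/orP.
  by move=> [w wB /(eq_set2 xy) [[-> ->]|[-> ->]]]; [left|right]; rewrite eqxx.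
by move=> [/andP [/eqP <- yB]|/andP [/eqP <- xB]]; [exists y | exists x] => //; rewrite setUC.
Qed.

Lemma star_sub e : e \in stars -> star e \subset cells.
Proof.
rewrite inE => eB; apply/subsetP => -[i|p]; rewrite inE //.
move=> /inr_starP [y yB ->]; rewrite /is_cell cards2.
by have -> : e.2 != y by apply: contraNneq eB => ->.
Qed.

Lemma deg_block i : deg star stars (inl i) = #|X| - k.
Proof.
have -> : #|X| - k = #|~: B i| by rewrite (cardsCs (~: B i)) setCK card_B.
rewrite -(card_imset (mem (~: B i)) (f := pair i)); last by move=> a b [].
apply: eq_card => -[j x]; rewrite !inE inl_star /=.
apply/andP/imsetP => [[h /eqP ->]|[y]]; first by exists x; rewrite ?inE.
by rewrite inE => h [-> ->].
Qed.

Variable lambda : nat.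
Hypothesis lambda_gt0 : 0 < lambda.
Hypothesis pair_deg : forall x y, x != y -> pair_degree B x y = lambda.

Definition replication x := #|[set i | x \in B i]|.

(** Counts in two ways the pairs of a point [y != x] and a block containing both [x] and [y]. *)
Lemma replicationE x : replication x * k.-1 = lambda * (#|X|).-1.
Proof.
have -> : (#|X|).-1 = #|[set~ x]| by rewrite cardsC1.
have <- : \sum_(y in [set~ x]) pair_degree B x y = lambda * #|[set~ x]|.
  rewrite mulnC -sum_nat_const; apply: eq_bigr => y.
  by rewrite !inE eq_sym; apply: pair_deg.
rewrite /replication -sum_nat_const.
have pe y : pair_degree B x y = \sum_(i in [set i | x \in B i]) (y \in B i : nat).
  rewrite /pair_degree -sum1_card -big_mkcondr /=.
  by apply: eq_bigl => i; rewrite !inE.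
rewrite (eq_bigr (fun y => \sum_(i in [set i | x \in B i]) (y \in B i : nat))); last by move=> y _; apply: pe.
rewrite exchange_big /=; apply: eq_bigr => i; rewrite inE => xi.
rewrite -(card_B i) (cardsD1 x) xi /= -sum1_card -big_mkcondr /=.
by apply: eq_bigl => y; rewrite !inE.
Qed.

Lemma sum_replication : \sum_x replication x = #|I| * k.
Proof.
rewrite (eq_bigr (fun x => \sum_i (x \in B i : nat))); last first.
  move=> x _; rewrite /replication -sum1_card -big_mkcond /=.
  by apply: eq_bigl => i; rewrite inE.
rewrite exchange_big /= -sum_nat_const; apply: eq_bigr => i _.
by rewrite -big_mkcond -(card_B i) sum1_card.
Qed.

(** An edge occupying the pair gives one of its points as colour to a block through the other. That
    block avoids the colour, so [lambda] of the blocks through the other point are excluded; the two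
    cases are disjoint. *)
Lemma deg_pair x y : x != y ->
  deg star stars (inr [set x; y]) = (replication x - lambda) + (replication y - lambda).
Proof.
move=> xy.
have half a b : a != b -> #|[set e in stars | (e.2 == a) && (b \in B e.1)]| = replication b - lambda.
  move=> ab; rewrite -(pair_deg ab) /pair_degree /replication.
  have -> : [set i | (a \in B i) && (b \in B i)] = [set i | b \in B i] :&: [set i | a \in B i].
    by apply/setP => i; rewrite !inE andbC.
  rewrite -cardsD -[RHS](card_imset _ (f := pair^~ a)); last by move=> i j [].
  apply: eq_card => -[i w]; rewrite !inE /=; apply/andP/imsetP.
    by move=> [h /andP [/eqP E bB]]; exists i; rewrite ?inE ?bB -?E ?h.
  by move=> [j]; rewrite !inE => /andP [h bB] [-> ->]; rewrite h eqxx bB.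
rewrite addnC -(half x y xy) -(half y x) 1?eq_sym // /deg -cardsUI.
rewrite [X in _ + X](_ : _ = 0) ?addn0.
  by apply: eq_card => e; rewrite !inE; case: (boolP (e \in stars)) => eS;
     [rewrite star_pair // -?andb_orr; move: eS; rewrite inE => -> | move: eS; rewrite inE => /negbTE ->].
apply/eqP; rewrite cards_eq0; apply/eqP/setP => e; rewrite !inE.
apply/negbTE/negP => /andP [/andP [_ /andP [/eqP h1 _]] /andP [_ /andP [/eqP h2 _]]].
by move: xy; rewrite -h1 h2 eqxx.
Qed.

(** Two blocks share no edge. A block and a pair determine the colour, as the point of the pair
    outside the block. Two distinct pairs on a common edge are [{x, a}] and [{x, b}]: the colour
    must be [x], and the block is one of the [lambda] through [a] and [b]. *)
Lemma codeg_star (z w : I + {set X}) : z != w -> codeg star stars z w <= lambda.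
Proof.
have bp i p : codeg star stars (inl i) (inr p) <= 1.
  apply/card_le1_eqP => -[j x] [j' x']; rewrite !inE !inl_star /=.
  move=> /andP [h /andP [/eqP ej /inr_starP [y /= yB ep]]].
  move=> /andP [h' /andP [/eqP ej' /inr_starP [y' /= yB' ep']]].
  subst j j'; congr pair.
  have xy : x' != y' by apply: contraNneq h' => ->.
  have := eq_set2 xy (etrans (esym ep') ep) => -[[//]|[E _]].
  by rewrite E yB in h'.
case: z w => [i|p] [j|q] zw.
- rewrite (_ : codeg _ _ _ _ = 0) //; apply/eqP; rewrite cards_eq0.
  apply/eqP/setP => e; rewrite !inE !inl_star; apply/negbTE/negP.
  by move=> /and3P [_ /eqP E1 /eqP E2]; rewrite E1 E2 eqxx in zw.
- exact: leq_trans (bp _ _) lambda_gt0.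
- rewrite /codeg; under eq_finset do rewrite (andbC (inr p \in _)).
  exact: leq_trans (bp j p) lambda_gt0.
- case: (set_0Vmem [set e in stars | (inr p \in star e) && (inr q \in star e)]) => [E|[[i x]]].
    by rewrite /codeg E cards0.
  rewrite !inE /= => /and3P [xB /inr_starP [a /= aB ep] /inr_starP [b /= bB eq]].
  have ab : a != b by apply: contraNneq zw => ab; rewrite ep eq ab.
  rewrite -(pair_deg ab) /pair_degree.
  rewrite -(card_imset _ (f := pair^~ x)); last by move=> ? ? [].
  apply: subset_leq_card; apply/subsetP => -[j w]; rewrite !inE /= => /andP [wB].
  have eS : (j, w) \in stars by rewrite inE.
  have xa : x != a by apply: contraNneq xB => ->.
  have xb : x != b by apply: contraNneq xB => ->.
  rewrite ep eq !star_pair //= => /andP [h1 h2]; apply/imsetP; exists j.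
    rewrite inE; case/orP: h1 => /andP [/eqP E1 m1]; case/orP: h2 => /andP [/eqP E2 m2];
      rewrite ?m1 ?m2 //.
    + by rewrite E1 in E2; rewrite E2 eqxx in xb.
    + by rewrite E1 in E2; rewrite E2 eqxx in xa.
    + by rewrite E1 in E2; rewrite E2 eqxx in ab.
  case/orP: h1 => /andP [/eqP E1 m1]; first by rewrite E1.
  case/orP: h2 => /andP [/eqP E2 m2]; first by rewrite E2.
  by rewrite E1 in E2; rewrite E2 eqxx in ab.
Qed.

(** An enlarged block that newly contains [x] and [y] occupies the pair [{x, y}] in its star. The
    stars are disjoint, so this happens at most once beyond the [lambda] original blocks. *)
Lemma matching_nesting M : matching star stars M ->
  (forall i, inl i \in covered star M) ->
  exists phi : I -> X, is_nesting #|X| k lambda B phi.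
Proof.
move=> [sM dM] cov.
have ex i : [exists x, (i, x) \in M].
  move: (cov i) => /bigcupP [[j x] jM]; rewrite inl_star /= => /eqP ->.
  by apply/existsP; exists x.
pose phi i := xchoose (existsP (ex i)).
have phiM i : (i, phi i) \in M by apply: (xchooseP (existsP (ex i))).
have phiB i : phi i \notin B i by have := subsetP sM _ (phiM i); rewrite inE.
exists phi; split => //.
  by move=> i; rewrite cardsU1 phiB card_B.
move=> x y xy; rewrite /pair_degree.
apply: (@leq_trans #|[set i | (x \in B i) && (y \in B i)] :|:
   [set i | inr [set x; y] \in star (i, phi i)]|).
  apply: subset_leq_card; apply/subsetP => i.
  rewrite !inE star_pair // ?inE ?phiB //=.
  rewrite ![_ == phi i]eq_sym => /andP [/orP [/eqP hx|->] /orP [/eqP hy|->]];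
    rewrite ?andbT ?orbT //.
  - by move: xy; rewrite -hx -hy eqxx.
  - by rewrite hx eqxx orbT.
  - by rewrite hy eqxx !orbT.
apply: leq_trans (leq_card_setU _ _) _.
rewrite -/(pair_degree B x y) (pair_deg xy) addnC -add1n leq_add2r.
apply/card_le1_eqP => i j; rewrite !inE => hi hj.
apply/eqP; apply: contraT => ij.
have d : [disjoint star (i, phi i) & star (j, phi j)].
  by apply: dM => //; apply: contraNneq ij => -[-> _].
by rewrite (disjointFr d hi) in hj.
Qed.

(* Each remaining block loses at most [k * l] choices to equal colours, at most
   [k * (cap * k)] to reversed pairs, and those points already used [cap] times. *)
Lemma complete_matching M0 (A l cap : nat) :
  matching star stars M0 ->
  (forall i, inl i \notin covered star M0 ->
     A <= #|[set x | (i, x) \in residual star stars M0]|) ->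
  (forall y, #|[set i | (inl i \notin covered star M0) && (y \in B i)]| <= l) ->
  (forall t, cap * t <= #|I| - #|M0| -> k * l + k * (cap * k) + t < A) ->
  exists2 M, matching star stars M & forall i, inl i \in covered star M.
Proof.
move=> mM0 hA hl hcap.
pose unc M := [set i | inl i \notin covered star M].
pose load M x := #|[set e in M :\: M0 | e.2 == x]|.
(* Induction on the number of uncovered blocks, for matchings extending [M0]; [load] counts the uses
   of a colour in the extension only. *)
suff main n M : #|unc M| <= n -> M0 \subset M -> matching star stars M ->
    (forall x, load M x <= cap) ->
    exists2 M', matching star stars M' & forall i, inl i \in covered star M'.
  apply: (main #|unc M0| M0) => // x.
  by rewrite /load setDv (_ : [set _ in _ | _] = set0) ?cards0 //; apply/setP => e; rewrite !inE.
elim: n M => [|n IH] M hn sM mM hload.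
  exists M => // i; apply/negPn/negP => hi.
  by move: hn; rewrite leqNgt => /negP; apply; rewrite card_gt0; apply/set0Pn; exists i; rewrite inE.
case: (set_0Vmem (unc M)) => [E|[i]].
  by apply: (IH M) => //; rewrite E cards0.
rewrite inE => iM.
have sub_cov : covered star M0 \subset covered star M.
  by apply/bigcupsP => e eM; apply: bigcup_sup; apply: (subsetP sM).
have iM0 : inl i \notin covered star M0 by apply: contraNN iM; apply: (subsetP sub_cov).
have [sMS dM] := mM.
have inj1 : {in M &, injective (fun e : I * X => e.1)}.
  move=> e f eM fM E; apply/eqP; apply: contraT => ef.
  have ie : inl e.1 \in star e by rewrite inl_star.
  by have := disjointFr (dM e f eM fM ef) ie; rewrite inl_star E eqxx.
have new1 e : e \in M :\: M0 -> inl e.1 \notin covered star M0.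
  rewrite inE => /andP [eM0 eM]; apply/negP => /bigcupP [f fM0]; rewrite inl_star => /eqP E.
  by move: eM0; rewrite (inj1 e f) ?fM0 // (subsetP sM).
have inj1' : {in M :\: M0 &, injective (fun e : I * X => e.1)}.
  by move=> e f; rewrite !inE => /andP [_ eM] /andP [_ fM]; apply: inj1.
have card_new : #|M :\: M0| <= #|I| - #|M0|.
  rewrite cardsD (setIidPr sM) leq_sub2r // -(card_in_imset inj1).
  exact: max_card.
(* A pair [{x, y}] with [y \in B i] is occupied by a new edge either with colour [x] and [y] in its
   block ([same]), or with colour [y] and [x] in its block ([rev]). Avoiding [full] keeps every load
   at most [cap], which in turn bounds [rev]. *)
pose same := \bigcup_(y in B i) (snd @: [set e in M :\: M0 | y \in B e.1]).
pose rev := \bigcup_(y in B i) \bigcup_(e in [set e in M :\: M0 | e.2 == y]) B e.1.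
pose full := [set x | cap <= load M x].
have c1 : #|same| <= k * l.
  rewrite -(card_B i); apply: card_bigcup_le => y _.
  apply: leq_trans (leq_imset_card _ _) _.
  apply: leq_trans (hl y).
  rewrite -(card_in_imset (f := fun e : I * X => e.1)); last first.
    by move=> e f; rewrite !inE => /andP [h1 _] /andP [h2 _]; apply: inj1'; rewrite inE.
  apply: subset_leq_card; apply/subsetP => j /imsetP [e he ->].
  by rewrite inE in he; case/andP: he => eN yB; rewrite inE new1.
have c2 : #|rev| <= k * (cap * k).
  rewrite -{1}(card_B i); apply: card_bigcup_le => y _.
  apply: (@leq_trans (load M y * k)); last by rewrite leq_mul2r hload orbT.
  by apply: card_bigcup_le => e _; rewrite card_B.
have c3 : cap * #|full| <= #|I| - #|M0|.
  apply: leq_trans card_new.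
  rewrite mulnC -sum_nat_const.
  apply: (@leq_trans (\sum_(x in full) load M x)).
    by apply: leq_sum => x; rewrite inE.
  apply: (@leq_trans (\sum_x load M x)).
    by rewrite [leqRHS](bigID (mem full)) /= leq_addr.
  rewrite -[leqRHS]sum1_card (partition_big (fun e : I * X => e.2) predT) //=.
  apply: leq_sum => x _; rewrite sum1dep_card /load leq_eqVlt.
  by apply/orP; left; apply/eqP; apply: eq_card => e; rewrite !inE.
have : 0 < #|[set x | (i, x) \in residual star stars M0] :\: (same :|: rev :|: full)|.
  rewrite cardsD subn_gt0; apply: leq_ltn_trans (subset_leq_card (subsetIr _ _)) _.
  apply: leq_trans (hA i iM0).
  apply: leq_ltn_trans (hcap _ c3).
  apply: leq_trans (leq_card_setU _ _) _; rewrite leq_add2r.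
  by apply: leq_trans (leq_card_setU _ _) _; apply: leq_add.
rewrite card_gt0 => /set0Pn [x]; rewrite !inE !negb_or => /andP [/andP [/andP [ns nr] nf] /andP [xB dx]].
(* Conflicts with [M0] are excluded by the choice of [x] in its residual, so a conflicting edge is
   new and falls under [same] or [rev]. *)
have eM : (i, x) \in residual star stars M.
  rewrite !inE xB /= -setI_eq0; apply/set0Pn => -[z]; rewrite inE => /andP [zs /bigcupP [e eM ze]].
  have eM0 : e \notin M0.
    apply/negP => eM0.
    have : z \in covered star M0 by apply/bigcupP; exists e.
    by rewrite (disjointFr dx zs).
  have eN : e \in M :\: M0 by rewrite inE eM0.
  have eS := subsetP sMS _ eM.
  case: z zs ze => [j|p].
    rewrite !inl_star /= => /eqP -> /eqP E; case/negP: iM.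
    by apply/bigcupP; exists e; rewrite ?inl_star ?E.
  move=> /inr_starP [y /= yB ->]; rewrite star_pair //; last by apply: contraNneq xB => ->.
  case/orP => /andP [/eqP E1 yE].
    by case/negP: ns; apply/bigcupP; exists y => //; apply/imsetP; exists e; rewrite ?inE ?eM ?eM0 ?yE ?E1.
  case/negP: nr; apply/bigcupP; exists y => //; apply/bigcupP; exists e => //.
  by rewrite !inE eM eM0 E1 eqxx.
apply: (IH ((i, x) |: M)).
- rewrite -ltnS; apply: leq_trans hn; apply: proper_card; apply/properP; split.
    apply/subsetP => j; rewrite !inE coveredU1 inE; apply: contraNN => h.
    by rewrite h orbT.
  by exists i; rewrite !inE ?iM // coveredU1 inE inl_star eqxx.
- by apply: subset_trans sM (subsetU1 _ _).
- exact: matchingU1.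
- move=> w; rewrite /load.
  case: (eqVneq w x) => [->|wx].
    apply: leq_trans (_ : (load M x).+1 <= cap); last by move: nf; rewrite -ltnNge.
    rewrite /load -add1n -(cards1 (i, x)).
    apply: leq_trans (leq_card_setU _ _); apply: subset_leq_card; apply/subsetP => e.
    by rewrite !inE => /andP [/andP [-> /orP [->|->]] ->]; rewrite ?orbT.
  apply: leq_trans (hload w); apply: subset_leq_card; apply/subsetP => e.
  rewrite !inE => /andP [/andP [-> /orP [/eqP ->|->]] /eqP E]; last by rewrite E eqxx.
  by rewrite -E /= eqxx in wx.
Qed.

End NestingHypergraph.

(** * Bounds on products of survival factors *)

Section Products.
Local Open Scope ring_scope.
Variable R : realType.

(** Each factor is at least [1 - c / T], hence at least [expR (- (2 * (c / T)))], and there are at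
    most [T] of them. *)
Lemma prod_sub_ge (a : nat -> R) (c T : R) (m : nat) :
  0 <= c -> 0 < T -> c / T <= 1 / 2 -> m%:R <= T ->
  (forall j, (j < m)%N -> 0 <= a j /\ a j <= c / T) ->
  expR (- (2 * c)) <= \prod_(j < m) (1 - a j).
Proof.
move=> c0 T0 cT mT ha.
have cT0 : 0 <= c / T by rewrite divr_ge0 // ltW.
apply: (@le_trans _ _ (\prod_(j < m) (1 - c / T))); last first.
  by apply: ler_prod => j _; have [h1 h2] := ha j (ltn_ord j); apply/andP; split; lra.
rewrite prodr_const card_ord.
apply: (@le_trans _ _ (expR (- (2 * (c / T))) ^+ m)); last first.
  have h := expR_sub_le cT0 cT; rewrite lerXn2r // nnegrE ?(ltW (expR_gt0 _)) //; lra.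
rewrite -expRM_natl ler_expR mulrN lerN2 mulrCA ler_wpM2l // mulrCA ler_piMr //.
by rewrite ler_pdivrMr // mul1r.
Qed.

(** The product of the factors [1 - 1 / (b - j)] telescopes. *)
Lemma prod_sub_le (a : nat -> R) (b m : nat) : (0 < b)%N -> (m <= b)%N ->
  (forall j, (j < m)%N -> (b - j)%:R^-1 <= a j /\ a j <= 1) ->
  \prod_(j < m) (1 - a j) <= (b - m)%:R / b%:R.
Proof.
move=> b0; elim: m => [_ _|m IH mb ha].
  by rewrite big_ord0 subn0 divff // pnatr_eq0 -lt0n.
have [h1 h2] := ha m (ltnSn m).
rewrite big_ord_recr /=.
have p0 : 0 <= \prod_(j < m) (1 - a j).
  by apply: prodr_ge0 => j _; have [_ h] := ha j (ltnW (ltn_ord j)); lra.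
have IH' : \prod_(j < m) (1 - a j) <= (b - m)%:R / b%:R.
  by apply: IH; [exact: ltnW | move=> j jm; apply: ha; apply: ltnW].
apply: (@le_trans _ _ ((b - m)%:R / b%:R * (1 - (b - m)%:R^-1))).
  by apply: ler_pM => //; lra.
have bm : (0 < b - m)%N by rewrite subn_gt0.
have -> : (b - m.+1)%:R = (b - m)%:R - 1 :> R by rewrite subnS -subn1 natrB.
have n1 : (b - m)%:R != 0 :> R by rewrite pnatr_eq0 -lt0n.
have n2 : b%:R != 0 :> R by rewrite pnatr_eq0 -lt0n.
move: ((b - m)%:R : R) (b%:R : R) n1 n2 => p q n1 n2.
by rewrite le_eqVlt; apply/orP; left; apply/eqP; field; rewrite ?n1 ?n2.
Qed.

End Products.

(** * Numbers of blocks and pairs in the design *)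

Section BlockCounts.
Variables (X I : finType) (B : I -> {set X}) (k lambda : nat).
Hypothesis card_B : forall i, #|B i| = k.
Hypothesis lambda_gt0 : 0 < lambda.
Hypothesis pair_deg : forall x y, x != y -> pair_degree B x y = lambda.
Hypothesis k_ge : 2 * lambda + 2 <= k.
Hypothesis v_ge : k * k < #|X|.
Implicit Types (x y : X) (i : I).

Let b := #|I|.
Let v := #|X|.

Lemma card_blocks_class : #|class (@is_block X I) (cells X I) true| = b.
Proof.
rewrite /b -[RHS]cardsT -(card_imset setT (f := inl : I -> I + {set X})); last by move=> ? ? [].
apply: eq_card => -[i|p]; rewrite !inE /=.
  by rewrite imset_f.
by rewrite andbF; apply/esym/negbTE/negP; case/imsetP.
Qed.

Lemma card_pairs_class : #|class (@is_block X I) (cells X I) false| = 'C(v, 2).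
Proof.
rewrite /v -card_draws -(card_imset _ (f := inr : {set X} -> I + {set X})); last by move=> ? ? [].
apply: eq_card => -[i|p]; rewrite !inE /=.
  by apply/esym/negbTE/negP; case/imsetP.
rewrite andbT; apply/idP/imsetP => [h|[q]]; first by exists p; rewrite ?inE.
by rewrite inE => h [->].
Qed.

Lemma card_cells : #|cells X I| = b + 'C(v, 2).
Proof.
rewrite -card_blocks_class -card_pairs_class -[LHS](cardsID [set z | is_block z]).
by congr (_ + _); apply: eq_card => z; rewrite !inE; case: (is_block z); rewrite ?andbT ?andbF.
Qed.

Lemma card_blocks : b * (k * k.-1) = lambda * (v * v.-1).
Proof.
rewrite mulnA -(sum_replication card_B) big_distrl /=.
rewrite (eq_bigr (fun=> lambda * v.-1)); last by move=> x _; apply: replicationE.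
by rewrite sum_nat_const mulnCA.
Qed.

Lemma card_pairs : lambda * (2 * 'C(v, 2)) = b * (k * k.-1).
Proof. by rewrite card_blocks bin2 mul2n halfK; congr (_ * _); rewrite oddM; case: v => // n; rewrite /= andNb subn0. Qed.

(** Fisher's inequality, immediate here from [card_blocks] because [k * (k - 1) <= v - 1]. *)
Lemma blocks_ge : v <= b.
Proof.
have h := card_blocks; have k2 := k_ge; have v2 := v_ge; have l := lambda_gt0.
rewrite -/v in v2.
have kk : k * k.-1 <= v.-1 by nia.
have : v * (k * k.-1) <= b * (k * k.-1) by rewrite h; nia.
by rewrite leq_pmul2r //; nia.
Qed.

Lemma blocks_le : b <= v * v.
Proof.
have h := card_blocks; have k2 := k_ge; have l := lambda_gt0.
have : b * (k * k.-1) <= v * v * (k * k.-1) by rewrite h; nia.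
by rewrite leq_pmul2r //; nia.
Qed.

Lemma remaining_true m : remaining (@is_block X I) (star_kappa k) (cells X I) m true = b - m.
Proof. by rewrite /remaining card_blocks_class mul1n. Qed.

(** The pairs never run out, thanks to [2 * lambda + 2 <= k]: after multiplication by [2 * lambda]
    there are [b * k * (k - 1)] of them, at most [b * k * (2 * lambda)] get used, and at least
    [b * k] remain. *)
Lemma remaining_false m : m <= b ->
  b * k <= 2 * lambda * remaining (@is_block X I) (star_kappa k) (cells X I) m false.
Proof.
move=> mb; rewrite /remaining card_pairs_class /= mulnBr.
have h := card_pairs; have k2 := k_ge; have l := lambda_gt0.
have -> : 2 * lambda * 'C(v, 2) = b * (k * k.-1) by rewrite -h; lia.
have h1 : 2 * lambda * (k * m) <= b * k * (2 * lambda).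
  by rewrite mulnC leq_mul2r [leqRHS]mulnC leq_mul2l mb !orbT.
have h2 : b * k * (2 * lambda).+1 <= b * k * k.-1 by rewrite leq_mul2l; lia.
rewrite mulnS in h2; rewrite mulnA leq_subRL; first by lia.
lia.
Qed.

End BlockCounts.

(** * Initial degrees of blocks and pairs *)

Section InitialDegree.
Local Open Scope ring_scope.
Variables (R : realType) (v k lambda : nat).
Hypothesis lambda_gt0 : (0 < lambda)%N.
Hypothesis k_ge : (2 * lambda + 2 <= k)%N.
Hypothesis v_ge : (k * k < v)%N.

(** For pairs this is twice [lambda * (v - 1) / (k - 1) - lambda], the value given by [deg_pair] and
    [replicationE]. *)
Definition initial_degree (c : bool) : R :=
  if c then v%:R - k%:R else (2 * lambda)%:R * (v%:R - k%:R) / (k%:R - 1).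

Lemma initial_degree_ge c : v%:R / k%:R <= initial_degree c.
Proof.
have k4 : 4 <= k%:R :> R by rewrite (ler_nat R 4); have := k_ge; have := lambda_gt0; lia.
have l1 : 1 <= lambda%:R :> R by rewrite ler1n.
have vk : k%:R * k%:R <= v%:R :> R by rewrite -natrM ler_nat ltnW.
have v0 : 0 <= v%:R :> R by [].
have vh : v%:R / 2 <= v%:R - k%:R :> R by nra.
have k0 : 0 < k%:R :> R by lra.
have k1 : 0 < k%:R - 1 :> R by lra.
case: c => /=.
  by apply: le_trans vh; rewrite ler_pdivrMr //; nra.
rewrite ler_pdivlMr // mulrAC ler_pdivrMr // natrM.
set w := v%:R - _ in vh *; set V := v%:R in v0 vh *.
have : V <= 2 * lambda%:R * w by nra.
nra.
Qed.

Lemma initial_degree_false_le : initial_degree false <= v%:R.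
Proof.
have k4 : 4 <= k%:R :> R by rewrite (ler_nat R 4); have := k_ge; have := lambda_gt0; lia.
have vk : k%:R * k%:R <= v%:R :> R by rewrite -natrM ler_nat ltnW.
have k1 : 0 < k%:R - 1 :> R by lra.
have l2 : (2 * lambda)%:R <= k%:R - 1 :> R.
  by rewrite lerBrDr natr1 ler_nat; have := k_ge; lia.
rewrite /= ler_pdivrMr // mulrC; apply: ler_pM => //; last by lra.
by nra.
Qed.

Lemma initial_degree_true_ge : v%:R / 2 <= initial_degree true.
Proof.
have k4 : 4 <= k%:R :> R by rewrite (ler_nat R 4); have := k_ge; have := lambda_gt0; lia.
have vk : k%:R * k%:R <= v%:R :> R by rewrite -natrM ler_nat ltnW.
by rewrite /=; nra.
Qed.

End InitialDegree.

(** * Decay rates of the two kinds of vertices *)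

Section Rates.
Local Open Scope ring_scope.
Variables (R : realType) (X I : finType) (B : I -> {set X}) (k lambda : nat).
Hypothesis card_B : forall i, #|B i| = k.
Hypothesis lambda_gt0 : (0 < lambda)%N.
Hypothesis pair_deg : forall x y, x != y -> pair_degree B x y = lambda.
Hypothesis k_ge : (2 * lambda + 2 <= k)%N.
Hypothesis v_ge : (k * k < #|X|)%N.

Let b := #|I|.
Let v := #|X|.
Let lft := remaining (@is_block X I) (star_kappa k) (cells X I).

Lemma blocks_gt0 : (0 < b)%N.
Proof.
have := blocks_ge card_B lambda_gt0 pair_deg k_ge v_ge.
by apply: leq_trans; apply: leq_trans v_ge.
Qed.

Lemma remaining_false_gt0 m : (m <= b)%N -> (0 < lft m false)%N.
Proof.
move=> mb; have := remaining_false card_B lambda_gt0 pair_deg k_ge v_ge mb.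
rewrite -/b -/lft => h.
have b0 := blocks_gt0; have k2 := k_ge.
rewrite lt0n; apply/eqP => E; move: h; rewrite E muln0 leqn0 muln_eq0; lia.
Qed.

Lemma hit_rate_true m : hit_rate R (star_kappa k) (lft m) true = (b - m)%:R^-1.
Proof. by rewrite /hit_rate /lft remaining_true // mul1r. Qed.

Lemma hit_rate_false m : (m <= b)%N ->
  hit_rate R (star_kappa k) (lft m) false <= (2 * lambda)%:R / b%:R.
Proof.
move=> mb; rewrite /hit_rate /=.
have b0 : 0 < b%:R :> R by rewrite ltr0n blocks_gt0.
have l0 : 0 < (lft m false)%:R :> R by rewrite ltr0n remaining_false_gt0.
rewrite ler_pdivrMr // mulrAC ler_pdivlMr // -!natrM ler_nat mulnC.
exact: remaining_false.
Qed.

Lemma decay_trueE m : decay R (star_kappa k) (lft m) true =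
  k%:R * hit_rate R (star_kappa k) (lft m) false.
Proof. by rewrite /decay big_bool /= mul1r addrAC subrr add0r. Qed.

Lemma decay_falseE m : decay R (star_kappa k) (lft m) false =
  (b - m)%:R^-1 + (k%:R - 1) * hit_rate R (star_kappa k) (lft m) false.
Proof. by rewrite /decay big_bool /= mul1r hit_rate_true; ring. Qed.

(** A block loses choices only through pairs, which stay plentiful. The bound is therefore valid up
    to the very end, and the proportion of choices kept does not depend on [Q]. *)
Lemma decay_true_le m : (m <= b)%N ->
  decay R (star_kappa k) (lft m) true <= (2 * lambda * k)%:R / b%:R.
Proof.
move=> mb; rewrite decay_trueE natrM [leRHS]mulrAC [leRHS]mulrC.
by apply: ler_wpM2l => //; apply: hit_rate_false.
Qed.

(** An edge through a pair is lost at least when its block is covered by another edge, which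
    accounts for the rate [1 / (b - m)]. *)
Lemma decay_false_ge m : (b - m)%:R^-1 <= decay R (star_kappa k) (lft m) false.
Proof.
rewrite decay_falseE lerDl mulr_ge0 ?hit_rate_ge0 // subr_ge0 ler1n.
by have := k_ge; lia.
Qed.

Lemma decay_le m Q c : (m < b)%N -> (b < (b - m) * Q)%N ->
  decay R (star_kappa k) (lft m) c <= (Q + 2 * lambda * k)%:R / b%:R.
Proof.
move=> mb hQ.
have b0 : 0 < b%:R :> R by rewrite ltr0n blocks_gt0.
have h0 := hit_rate_ge0 R (star_kappa k) (lft m) false.
have hk : k%:R * hit_rate R (star_kappa k) (lft m) false <= (2 * lambda * k)%:R / b%:R.
  by rewrite -decay_trueE decay_true_le // ltnW.
have q0 : 0 <= Q%:R / b%:R :> R by rewrite divr_ge0.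
case: c.
  by rewrite decay_trueE natrD mulrDl; lra.
have hb : (b - m)%:R^-1 <= Q%:R / b%:R :> R.
  have bm : 0 < (b - m)%:R :> R by rewrite ltr0n subn_gt0.
  rewrite -[leLHS]mul1r ler_pdivrMr // mulrAC ler_pdivlMr // mul1r -natrM ler_nat mulnC.
  exact: ltnW.
rewrite decay_falseE natrD mulrDl; lra.
Qed.

Lemma initial_degreeE z : z \in cells X I ->
  (deg (star B) (stars B) z)%:R = initial_degree R v k lambda (is_block z).
Proof.
have kv : (k <= v)%N by apply: leq_trans (ltnW v_ge); rewrite leq_pmulr //; have := k_ge; lia.
have k1 : (0 < k.-1)%N by have := k_ge; lia.
have kE : k%:R - 1 = k.-1%:R :> R by rewrite -subn1 natrB //; have := k_ge; lia.
rewrite /initial_degree; case: z => [i|p] zc /=.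
  by rewrite (deg_block card_B) natrB.
have /cards2P [x [y [xy ->]]] : #|p| == 2 by move: zc; rewrite inE.
have rE w : (replication B w - lambda)%:R = lambda%:R * (v%:R - k%:R) / (k%:R - 1) :> R.
  have h := replicationE card_B pair_deg w; rewrite -/v in h.
  have lr : (lambda <= replication B w)%N.
    by rewrite -(leq_pmul2r k1) h leq_mul2l; apply/orP; right; lia.
  have vE : v%:R - k%:R = v.-1%:R - k.-1%:R :> R.
    by rewrite -!natrB; [congr (_%:R); lia | lia | lia].
  have k1n : k.-1%:R != 0 :> R by rewrite pnatr_eq0 -lt0n.
  rewrite kE vE natrB // mulrBr -natrM -h natrM.
  by move: (k.-1%:R : R) k1n => K k1n; field.
rewrite (deg_pair pair_deg xy) natrD !rE natrM.
by ring.
Qed.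

End Rates.

(** An edge whose block contains [y] has a colour [x != y] and occupies [{x, y}]. Counting these
    edges by block and by colour turns small pair degrees into few remaining blocks through [y]. *)
Lemma sum_deg_block_le (X I : finType) (B : I -> {set X}) (H : {set I * X}) (y : X)
    (J : {set I}) : H \subset stars B -> (forall i, i \in J -> y \in B i) ->
  \sum_(i in J) deg (star B) H (inl i) <=
  \sum_(x in [set~ y]) deg (star B) H (inr [set x; y]).
Proof.
move=> sH hJ; pose S := [set e in H | y \in B e.1].
apply: (@leq_trans #|S|).
  rewrite -sum1_card (partition_big (fun e : I * X => e.1) predT) //=.
  rewrite [leqRHS](bigID (mem J)) /=; apply: leq_trans (leq_addr _ _).
  apply: leq_sum => i iJ; rewrite sum1dep_card; apply: subset_leq_card.
  apply/subsetP => e; rewrite inE => /andP [eH]; rewrite inl_star => /eqP E.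
  by rewrite !inE eH -E hJ ?eqxx.
rewrite -sum1_card (partition_big (fun e : I * X => e.2) (mem [set~ y])) /=; last first.
  move=> e; rewrite !inE => /andP [eH yB].
  by have := subsetP sH _ eH; rewrite inE; apply: contraNneq => ->.
apply: leq_sum => x; rewrite !inE => xy; rewrite sum1dep_card; apply: subset_leq_card.
apply/subsetP => e; rewrite !inE => /andP [/andP [eH yB] /eqP E].
by rewrite eH star_pair ?(subsetP sH) // E eqxx yB.
Qed.

(** * Inequalities between the parameters of the process *)

Section Numerics.
Local Open Scope ring_scope.
Variable R : realType.

Lemma edge_loss_small (C b Q g v eps0 : R) :
  0 < b -> 0 < Q -> 0 < g -> 0 < v -> 0 < eps0 ->
  16 * C * Q / (3 * eps0 * g) <= v ->
  C / (3 / 4 * (b / Q * (g * v))) <= eps0 / (4 * b).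
Proof.
move=> b0 Q0 g0 v0 e0 h.
have eg : 0 < 3 * eps0 * g by rewrite !mulr_gt0.
have N0 : 0 < 3 / 4 * (b / Q * (g * v)) by rewrite !mulr_gt0 ?invr_gt0.
rewrite ler_pdivrMr // in h; rewrite ler_pdivrMr //.
have -> : eps0 / (4 * b) * (3 / 4 * (b / Q * (g * v))) = v * (3 * eps0 * g) / (16 * Q).
  by field; rewrite !gt_eqF.
rewrite ler_pdivlMr; [lra | by rewrite mulr_gt0].
Qed.

Lemma step_size_small (s b K0 K1 C g : R) :
  1 <= s -> s ^+ 2 <= b -> 0 <= K0 -> 0 <= K1 -> 0 < g ->
  2 * (4 * K0 + K1 + 2 * (C / g)) <= s ->
  s * (4 * (K0 / b) + 2 * (C / (g * s ^+ 2)) + K1 / b) <= 1 / 2.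
Proof.
move=> s1 sb K00 K10 g0 h.
have s0 : 0 < s by lra.
have s20 : 0 < s ^+ 2 by rewrite exprn_gt0.
have b0 : 0 < b by apply: lt_le_trans sb.
have bi : b^-1 <= (s ^+ 2)^-1 by rewrite lef_pV2.
apply: (@le_trans _ _ (s * (4 * (K0 / s ^+ 2) + 2 * (C / (g * s ^+ 2)) + K1 / s ^+ 2))).
  apply: ler_wpM2l; first exact: ltW.
  by apply: lerD; [apply: lerD => //; rewrite ler_wpM2l // ler_wpM2l | rewrite ler_wpM2l].
have -> : s * (4 * (K0 / s ^+ 2) + 2 * (C / (g * s ^+ 2)) + K1 / s ^+ 2) =
   (4 * K0 + K1 + 2 * (C / g)) / s by field; rewrite !gt_eqF.
rewrite ler_pdivrMr //; lra.
Qed.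

(** With degrees of order [s ^+ 2] and [s ^+ 2 <= b], every term is of order [1 / b], so its total
    effect over [b] steps is a constant factor. *)
Lemma variance_small (s b K0 K1 C g : R) :
  0 < s -> s ^+ 2 <= b -> 0 <= K0 -> 0 <= K1 -> 0 < g ->
  s ^+ 2 * (64 * (K0 / b) ^+ 2 + 32 * (C * (K0 / b + K1 / b) / (g * s ^+ 2)) + 2 * (K1 / b) ^+ 2)
  <= 2 * (64 * K0 ^+ 2 + 32 * (C * (K0 + K1) / g) + 2 * K1 ^+ 2) / (2 * b).
Proof.
move=> s0 sb K00 K10 g0.
have s20 : 0 < s ^+ 2 by rewrite exprn_gt0.
have b0 : 0 < b by apply: lt_le_trans sb.
have sn : s != 0 by rewrite gt_eqF.
have bn : b != 0 by rewrite gt_eqF.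
have gn : g != 0 by rewrite gt_eqF.
set P := 64 * K0 ^+ 2 + 2 * K1 ^+ 2.
have P0 : 0 <= P by rewrite addr_ge0 // mulr_ge0 // sqr_ge0.
have -> : s ^+ 2 * (64 * (K0 / b) ^+ 2 + 32 * (C * (K0 / b + K1 / b) / (g * s ^+ 2)) + 2 * (K1 / b) ^+ 2)
  = s ^+ 2 * (P / b ^+ 2) + 32 * (C * (K0 + K1) / g) / b.
  by rewrite /P; field; rewrite ?sn ?bn ?gn.
have -> : 2 * (64 * K0 ^+ 2 + 32 * (C * (K0 + K1) / g) + 2 * K1 ^+ 2) / (2 * b)
  = b * (P / b ^+ 2) + 32 * (C * (K0 + K1) / g) / b.
  by rewrite /P; field; rewrite ?sn ?bn ?gn.
by rewrite lerD2r ler_wpM2r // divr_ge0 // sqr_ge0.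
Qed.

(** The degree-five term [(s * eps0) ^+ 5 / 120] of the exponential series beats the [2 * s ^+ 4]
    vertices; 481 comes from [4 * 120]. *)
Lemma initial_potential_small (U s eps0 C1 : R) :
  0 < s -> 0 < eps0 -> U <= 2 * s ^+ 4 -> 481 * expR C1 / eps0 ^+ 5 <= s ->
  U * (2 * expR (- (s * eps0))) * expR C1 < 1.
Proof.
move=> s0 e0 hU h.
have e5 : 0 < eps0 ^+ 5 by rewrite exprn_gt0.
have s4 : 0 < s ^+ 4 by rewrite exprn_gt0.
rewrite ler_pdivrMr // in h.
have E0 := expR_gt0 C1.
have big : (s * eps0) ^+ 5 / 120 < expR (s * eps0).
  have := @expR_ge1Dxn _ (s * eps0) 4 (ltW (mulr_gt0 s0 e0)).
  rewrite (_ : 5`!%:R = 120) //; lra.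
have Ep := expR_gt0 (s * eps0).
rewrite expRN mulrAC mulrA ltr_pdivrMr // mul1r.
apply: le_lt_trans big.
apply: (@le_trans _ _ (4 * s ^+ 4 * expR C1)).
  rewrite mulrAC ler_wpM2r ?(ltW E0) //; lra.
have -> : (s * eps0) ^+ 5 / 120 = s ^+ 4 * (s * eps0 ^+ 5 / 120) by field.
have -> : 4 * s ^+ 4 * expR C1 = s ^+ 4 * (4 * expR C1) by ring.
rewrite ler_wpM2l ?(ltW s4) //; lra.
Qed.

End Numerics.

Lemma lt_sub_divn b Q m : 0 < Q -> m < b - b %/ Q -> b < (b - m) * Q.
Proof.
move=> Q0 hm; apply: (@leq_trans ((b %/ Q).+1 * Q)); first by rewrite -ltn_divLR.
by rewrite leq_mul2r; apply/orP; right; lia.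
Qed.

(** * A matching covering all but a fraction [1 / Q] of the blocks *)

Section AlmostNesting.
Local Open Scope ring_scope.
Variables (R : realType) (k lambda : nat).
Hypothesis lambda_gt0 : (0 < lambda)%N.
Hypothesis k_ge : (2 * lambda + 2 <= k)%N.

(** Run [greedy_matching] with the number of blocks as time scale and [s] the square root of the
    number of points. By [decay_true_le] block degrees keep a factor independent of [Q], while by
    [decay_false_ge] pair degrees fall by a factor [Q]. *)
Lemma almost_nesting (Q : nat) : (0 < Q)%N ->
  exists W : R, forall (X I : finType) (B : I -> {set X}),
    (forall i, #|B i| = k) ->
    (forall x y, x != y -> pair_degree B x y = lambda) ->
    (k * k < #|X|)%N -> W <= Num.sqrt #|X|%:R ->
  exists M, [/\ matching (star B) (stars B) M,
    #|M| = (#|I| - #|I| %/ Q)%N,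
    forall i, inl i \notin covered (star B) M ->
      3 / 8 * expR (- (2 * (2 * lambda * k)%:R)) * #|X|%:R
        <= (deg (star B) (residual (star B) (stars B) M) (inl i))%:R :> R &
    forall x y, x != y ->
      (deg (star B) (residual (star B) (stars B) M) (inr [set x; y]))%:R
        <= 5 / 4 * (#|X|%:R / Q%:R) :> R].
Proof.
move=> Q0.
(* [K0 / b] bounds the rates as in [decay_le], [g * v] bounds the ideal degrees from below, and
   [eps0] makes the final slack [eps0 * expR K1] equal to [1 / 4]. *)
pose K0 : R := (Q + 2 * lambda * k)%:R.
pose K1 : R := 12 * K0 + 1.
pose g : R := expR (- (2 * K0)) / k%:R.
pose eps0 : R := expR (- K1) / 4.
pose C' : R := ((edge_size (star_kappa k)) * lambda)%:R.
pose C : R := ((edge_size (star_kappa k)) ^ 2 * lambda)%:R.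
pose C1 : R := 2 * (64 * K0 ^+ 2 + 32 * (C' * (K0 + K1) / g) + 2 * K1 ^+ 2).
have k0 : (0 < k)%N by have := k_ge; lia.
have kR : 0 < k%:R :> R by rewrite ltr0n.
have QR : 0 < Q%:R :> R by rewrite ltr0n.
have K00 : 0 <= K0 by rewrite /K0.
have K10 : 0 <= K1 by rewrite /K1; lra.
have g0 : 0 < g by rewrite /g divr_gt0 // expR_gt0.
have e0 : 0 < eps0 by rewrite /eps0 divr_gt0 // expR_gt0.
have C'0 : 0 <= C' by rewrite /C'.
have C0 : 0 <= C by rewrite /C.
have eK : eps0 * expR K1 <= 1 / 4.
  by rewrite /eps0 mulrAC [expR (- _) * _]mulrC expRxMexpNx_1.
have K1E : K1 = 12 * K0 + 1 by [].
have gE : g = expR (- (2 * K0)) / k%:R by [].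
have C1E : C1 = 2 * (64 * K0 ^+ 2 + 32 * (C' * (K0 + K1) / g) + 2 * K1 ^+ 2) by [].
have C'E : C' = (edge_size (star_kappa k) * lambda)%:R by [].
have CE : C = (edge_size (star_kappa k) ^ 2 * lambda)%:R by [].
have K0E : K0 = (Q + 2 * lambda * k)%:R by [].
clearbody C1; clearbody C C' eps0 g; clearbody K1; clearbody K0.
(* Thresholds on [s] required by [edge_loss_small], [step_size_small] and
   [initial_potential_small]. *)
pose w2 := 16 * C * Q%:R / (3 * eps0 * g).
pose w3 := 2 * (4 * K0 + K1 + 2 * (C' / g)).
pose w4 := 481 * expR C1 / eps0 ^+ 5.
have w2E : w2 = 16 * C * Q%:R / (3 * eps0 * g) by [].
have w3E : w3 = 2 * (4 * K0 + K1 + 2 * (C' / g)) by [].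
have w4E : w4 = 481 * expR C1 / eps0 ^+ 5 by [].
have w20 : 0 <= w2.
  have eg : 0 <= 3 * eps0 * g by apply: ltW; rewrite !mulr_gt0.
  by apply: divr_ge0 eg; rewrite mulr_ge0 // mulr_ge0.
have w30 : 0 <= w3.
  have : 0 <= C' / g by rewrite divr_ge0 // ltW.
  by rewrite w3E; lra.
have w40 : 0 <= w4.
  apply: divr_ge0; first by rewrite mulr_ge0 // ltW // expR_gt0.
  by rewrite exprn_ge0 // ltW.
clearbody w2 w3 w4.
exists (1 + 2 * K0 + w2 + w3 + w4) => X I B card_B pair_deg v_ge hW.
set v := #|X| in v_ge hW *; set b := #|I|; set s := Num.sqrt _ in hW.
have s2 : s ^+ 2 = v%:R by rewrite /s sqr_sqrtr.
have s1 : 1 <= s by lra.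
have sw2 : w2 <= s by lra.
have sw3 : w3 <= s by lra.
have sw4 : w4 <= s by lra.
have sK0 : 2 * K0 <= s by lra.
have s0 : 0 < s by lra.
have sv : s <= v%:R by rewrite -s2 expr2 ler_peMr // ltW.
have v0 : 0 < v%:R :> R by lra.
have bv : v%:R <= b%:R :> R.
  by rewrite ler_nat; apply: (blocks_ge card_B lambda_gt0 pair_deg k_ge v_ge).
have bv2 : (b <= v * v)%N by apply: (blocks_le card_B lambda_gt0 pair_deg k_ge v_ge).
have b0 : 0 < b%:R :> R by lra.
have b0n : (0 < b)%N by rewrite -(ltr_nat R).
pose n1 := (b %/ Q)%N.
pose m0 := (b - n1)%N.
have m0b : (m0 <= b)%N by apply: leq_subr.
have lt_m0 m : (m < m0)%N -> (m < b)%N /\ (b < (b - m) * Q)%N.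
  move=> mm; split; first exact: leq_trans mm m0b.
  exact: lt_sub_divn.
have K0b : K0 / b%:R <= 1 / 2 by rewrite ler_pdivrMr //; lra.
pose D0 := @initial_degree R v k lambda.
pose lft := remaining (@is_block X I) (star_kappa k) (cells X I).
have kap0 c : (0 < star_kappa k c)%N by case: c.
have dec_le m c : (m < m0)%N -> decay R (star_kappa k) (lft m) c <= K0 / b%:R.
  by rewrite K0E; move=> /lt_m0 [h1 h2]; apply: (decay_le R card_B lambda_gt0 pair_deg k_ge v_ge c h1 h2).
have dec_ge m c : 0 <= decay R (star_kappa k) (lft m) c by apply: decay_ge0.
have prodK m c : (m <= m0)%N -> expR (- (2 * K0)) <= \prod_(j < m) (1 - decay R (star_kappa k) (lft j) c).
  move=> mm; apply: (@prod_sub_ge _ (fun j => decay R (star_kappa k) (lft j) c) K0 b%:R) => //.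
    by rewrite ler_nat (leq_trans mm).
  by move=> j jm; split; [exact: dec_ge | apply: dec_le; apply: leq_trans mm].
have idG m c : (m <= m0)%N -> g * v%:R <= ideal (@is_block X I) (star_kappa k) (cells X I) D0 m c.
  move=> mm; rewrite /ideal.
  have -> : g * v%:R = v%:R / k%:R * expR (- (2 * K0)) by rewrite gE; field; rewrite gt_eqF.
  apply: ler_pM; rewrite ?divr_ge0 ?(ltW (expR_gt0 _)) //.
    exact: (initial_degree_ge R lambda_gt0 k_ge v_ge).
  exact: prodK.
have lpos m c : (m < m0)%N -> (0 < lft m c)%N.
  move=> /lt_m0 [h1 h2]; case: c.
    by rewrite /lft remaining_true // subn_gt0.
  exact: (remaining_false_gt0 card_B lambda_gt0 pair_deg k_ge v_ge (ltnW h1)).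
have c0b : (2 * lambda * k)%:R / b%:R <= K0 / b%:R.
  by apply: ler_wpM2r; rewrite ?invr_ge0 // K0E ler_nat leq_addl.
have prodA : expR (- (2 * (2 * lambda * k)%:R)) <= \prod_(j < m0) (1 - decay R (star_kappa k) (lft j) true).
  apply: (@prod_sub_ge _ (fun j => decay R (star_kappa k) (lft j) true) _ b%:R) => //.
  - exact: le_trans c0b K0b.
  - by rewrite ler_nat.
  - move=> j jm; split; first exact: dec_ge.
    exact: (decay_true_le R card_B lambda_gt0 pair_deg k_ge v_ge (ltnW (leq_trans jm m0b))).
have prodP : \prod_(j < m0) (1 - decay R (star_kappa k) (lft j) false) <= Q%:R^-1.
  apply: (@le_trans _ _ ((b - m0)%:R / b%:R)).
    apply: (@prod_sub_le _ (fun j => decay R (star_kappa k) (lft j) false)) => // j jm.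
    split; first exact: (decay_false_ge R I lambda_gt0 k_ge v_ge).
    apply: le_trans (dec_le j false jm) _; apply: le_trans K0b _.
    by rewrite ler_pdivrMr // mul1r (ler_nat R 1 2).
  have -> : (b - m0 = n1)%N by rewrite /m0 subKn // leq_div.
  by rewrite ler_pdivrMr // mulrC ler_pdivlMr // -natrM ler_nat leq_trunc_div.
have G0 : 0 < g * v%:R by apply: mulr_gt0.
have NN0 : 0 < 3 / 4 * (b%:R / Q%:R * (g * v%:R)).
  apply: mulr_gt0; first by rewrite divr_gt0.
  by apply: mulr_gt0 => //; apply: divr_gt0.
have vb2 : s ^+ 2 <= b%:R by rewrite s2.
have U2 : #|cells X I|%:R <= 2 * s ^+ 4.
  have -> : s ^+ 4 = (v * v)%:R by rewrite natrM -s2; ring.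
  rewrite -natrM ler_nat card_cells mul2n -addnn leq_add //.
  rewrite bin2; apply: leq_trans (leq_mul (leqnn v) (leq_pred v)).
  by rewrite -divn2 leq_div.
have [|//|//|//|//|//|//|||//|//|//|//|||//||||M [mM cM hM]] :=
  @greedy_matching R _ _ (star B) (@is_block X I) (star_kappa k)
   (stars B) (cells X I) lambda (@star_sub _ _ B) (card_star card_B)
   (codeg_star lambda_gt0 pair_deg) kap0 D0 b%:R K0 K1 (g * v%:R)
   (3 / 4 * (b%:R / Q%:R * (g * v%:R))) eps0 s C1 m0.
- move=> z zc; exact: (initial_degreeE R card_B lambda_gt0 pair_deg k_ge v_ge zc).
- exact: ltW.
- by rewrite ler_nat.
- move=> m mm; rewrite mul1r; apply: ler_wpM2l; first by rewrite divr_ge0.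
  apply: ler_wpM2r; first exact: ltW.
  have [h1 h2] := lt_m0 m mm.
  by rewrite remaining_true // ler_pdivrMr // -natrM ler_nat ltnW.
- rewrite -CE; apply: edge_loss_small => //.
  by rewrite -w2E; apply: le_trans sw2 sv.
- by rewrite -C'E -s2; apply: step_size_small => //; rewrite -w3E.
- by rewrite -C'E -s2 C1E; apply: variance_small.
- by apply: initial_potential_small => //; rewrite -w4E.
exists M; split => //.
- move=> i iM.
  have iU : inl i \in cells X I :\: covered (star B) M by rewrite inE iM inE.
  have := hM _ iU; rewrite /= => hi.
  have id1 := idG m0 true (leqnn _).
  have id0 : 0 < ideal (@is_block X I) (star_kappa k) (cells X I) D0 m0 true.
    exact: lt_le_trans id1.
  move: hi; rewrite ler_distl => /andP [hi _].
  rewrite ler_pdivlMr // in hi; apply: le_trans hi.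
  (* The [3 / 8] is [3 / 4] for the deviation from the ideal degree times [1 / 2] for the initial
     degree. *)
  apply: (@le_trans _ _ (3 / 4 * (v%:R / 2 * expR (- (2 * (2 * lambda * k)%:R))))).
    by rewrite le_eqVlt; apply/orP; left; apply/eqP; field.
  have -> : 1 - 1 / 4 = 3 / 4 :> R by field.
  apply: ler_wpM2l; first by rewrite divr_ge0.
  apply: ler_pM => //; first by rewrite divr_ge0.
    exact: ltW (expR_gt0 _).
  exact: (initial_degree_true_ge R lambda_gt0 k_ge v_ge).
- move=> x y xy.
  have vQ : 0 <= 5 / 4 * (v%:R / Q%:R) :> R.
    by rewrite mulr_ge0 // divr_ge0.
  case: (boolP (inr [set x; y] \in covered (star B) M)) => pM.
    rewrite (_ : deg _ _ _ = 0%N) //; apply/eqP; rewrite cards_eq0; apply/eqP/setP => e.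
    rewrite !inE; apply/negbTE/negP => /andP [/andP [_ de] pe].
    by rewrite (disjointFr de pe) in pM.
  have pU : inr [set x; y] \in cells X I :\: covered (star B) M.
    by rewrite inE pM inE /= cards2 xy.
  have := hM _ pU; rewrite /= => hi.
  have id1 := idG m0 false (leqnn _).
  have id0 : 0 < ideal (@is_block X I) (star_kappa k) (cells X I) D0 m0 false.
    exact: lt_le_trans id1.
  move: hi; rewrite ler_distl => /andP [_ hi].
  rewrite ler_pdivrMr // in hi; apply: le_trans hi _.
  have -> : 1 + 1 / 4 = 5 / 4 :> R by field.
  apply: ler_wpM2l; first by rewrite divr_ge0.
  rewrite /ideal; apply: ler_pM => //.
  + by apply: le_trans (initial_degree_ge R lambda_gt0 k_ge v_ge false); rewrite divr_ge0.
  + exact: le_trans (ltW (expR_gt0 _)) (prodK m0 false (leqnn _)).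
  + exact: (initial_degree_false_le R lambda_gt0 k_ge v_ge).
Qed.

End AlmostNesting.

(** * Choice of constants and greedy completion *)

Section Completion.
Local Open Scope ring_scope.
Variable R : realType.

(** The three kinds of forbidden colours number at most [u / 40], [u / 8] and [u / 10], together
    [u / 4], while [A > 3 / 8 * u - 1] and [u >= 16]. *)
Lemma completion_budget (u y : R) (k l cap t A : nat) :
  (0 < k)%N -> 0 < y -> 160 * k%:R ^+ 2 * y <= u -> 16 * k%:R ^+ 2 <= u ->
  l%:R <= 4 * y -> 8 * k%:R ^+ 2 * cap%:R <= u -> u <= 16 * k%:R ^+ 2 * cap%:R ->
  (cap * t)%:R <= u * y -> 3 / 8 * u < A%:R + 1 ->
  (k * l + k * (cap * k) + t < A)%N.
Proof.
move=> k0 y0 hy hu hl hcap hcap' ht hA.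
have kR : 1 <= k%:R :> R by rewrite ler1n.
have k2 : k%:R <= k%:R ^+ 2 :> R by rewrite expr2 ler_peMr.
have u0 : 0 < u by lra.
have kl : k%:R * l%:R <= u / 40.
  apply: (@le_trans _ _ (k%:R ^+ 2 * (4 * y))); last by lra.
  by apply: ler_pM => //; lra.
have tu : t%:R <= u / 10.
  have h : u * t%:R <= u * (16 * k%:R ^+ 2 * y).
    apply: (@le_trans _ _ (16 * k%:R ^+ 2 * (cap * t)%:R)).
      by rewrite natrM mulrA ler_wpM2r.
    rewrite [leRHS]mulrCA ler_wpM2l //; lra.
  rewrite ler_pM2l // in h; lra.
rewrite -(ltr_nat R) !natrD !natrM.
have -> : k%:R * (cap%:R * k%:R) = k%:R ^+ 2 * cap%:R :> R by ring.
lra.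
Qed.

Lemma leftover_bound (X I : finType) (B : I -> {set X}) (M : {set I * X}) (al c : R) (y : X) :
  0 <= c ->
  (forall i, inl i \notin covered (star B) M ->
     al <= (deg (star B) (residual (star B) (stars B) M) (inl i))%:R) ->
  (forall x y, x != y ->
     (deg (star B) (residual (star B) (stars B) M) (inr [set x; y]))%:R <= c) ->
  #|[set i | (inl i \notin covered (star B) M) && (y \in B i)]|%:R * al <= #|X|%:R * c.
Proof.
move=> c0 hal hc; set J := [set i | _].
have sH : residual (star B) (stars B) M \subset stars B.
  by apply/subsetP => e; rewrite inE => /andP [].
have hJ i : i \in J -> y \in B i by rewrite inE => /andP [].
have := sum_deg_block_le sH hJ; rewrite -(ler_nat R) !natr_sum => h.
apply: (@le_trans _ _ (\sum_(i in J) (deg (star B) (residual (star B) (stars B) M) (inl i))%:R)).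
  rewrite mulr_natl -sumr_const; apply: ler_sum => i.
  by rewrite inE => /andP [iM _]; apply: hal.
apply: le_trans h _.
apply: (@le_trans _ _ (\sum_(x in [set~ y]) c)).
  by apply: ler_sum => x; rewrite !inE => xy; apply: hc.
by rewrite sumr_const -[leLHS]mulr_natl ler_wpM2r // ler_nat max_card.
Qed.

Lemma BIBD_nesting_eventually (k lambda : nat) :
  (0 < lambda)%N -> (2 * lambda + 2 <= k)%N ->
  exists v0 : nat, forall (X I : finType) (B : I -> {set X}),
    (forall i, #|B i| = k) ->
    (forall x y, x != y -> pair_degree B x y = lambda) ->
    (v0 <= #|X|)%N -> exists phi : I -> X, is_nesting #|X| k lambda B phi.
Proof.
move=> lambda_gt0 k_ge.
have k0 : (0 < k)%N by lia.
pose a : R := expR (- (2 * (2 * lambda * k)%:R)).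
have a0 : 0 < a by apply: expR_gt0.
(* Since [a] does not involve [Q], one may take [Q] large in terms of [a]; this choice gives
   [160 * k ^ 2 * y <= u] below. *)
pose Q := (Num.truncn (160 * k%:R ^+ 2 / a ^+ 2)).+1.
have QR : 0 < Q%:R :> R by rewrite ltr0n.
have hQ : 160 * k%:R ^+ 2 / a ^+ 2 <= Q%:R by apply/ltW/truncnS_gt.
have [W hW] := almost_nesting R lambda_gt0 k_ge (ltn0Sn _ : (0 < Q)%N).
pose w : R := W ^+ 2 + 16 * k%:R ^+ 2 / a.
exists (k * k + Num.truncn w).+1 => X I B card_B pair_deg hX.
have v_ge : (k * k < #|X|)%N by apply: leq_trans hX; rewrite ltnS leq_addr.
have wv : w <= #|X|%:R.
  apply/ltW; apply: lt_le_trans (truncnS_gt w) _.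
  by rewrite ler_nat; apply: leq_trans hX; rewrite ltnS leq_addl.
have w1 : 0 <= 16 * k%:R ^+ 2 / a :> R by rewrite divr_ge0 ?(ltW a0) // mulr_ge0 // exprn_ge0.
have Ws : W <= Num.sqrt #|X|%:R.
  apply: le_trans (ler_norm _) _; rewrite -sqrtr_sqr ler_sqrt //.
  by apply: le_trans wv; rewrite /w lerDl.
have W2 : 16 * k%:R ^+ 2 / a <= #|X|%:R by apply: le_trans wv; rewrite /w lerDr sqr_ge0.
have v0 : 0 < #|X|%:R :> R by rewrite ltr0n; apply: leq_trans v_ge.
have kR : 1 <= k%:R :> R by rewrite ler1n.
have k2 : 1 <= k%:R ^+ 2 :> R by rewrite exprn_ege1.
(* [u] is the scale of the number of colours available to a remaining block, [y] that of the number
   of remaining blocks through a point; [u * y] bounds the number of remaining blocks, as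
   [b <= v ^ 2]. *)
pose u := a * #|X|%:R; pose y := #|X|%:R / (a * Q%:R).
have u0 : 0 < u by apply: mulr_gt0.
have aQ : 0 < a * Q%:R by apply: mulr_gt0.
have y0 : 0 < y by apply: divr_gt0.
have u16 : 16 * k%:R ^+ 2 <= u by move: W2; rewrite ler_pdivrMr // [leRHS]mulrC.
have yu : 160 * k%:R ^+ 2 * y <= u.
  rewrite /y mulrA ler_pdivrMr //.
  rewrite ler_pdivrMr ?exprn_gt0 // in hQ.
  have -> : u * (a * Q%:R) = Q%:R * a ^+ 2 * #|X|%:R by rewrite /u; ring.
  by rewrite ler_wpM2r.
have yE : u * y = #|X|%:R ^+ 2 / Q%:R by rewrite /u /y; field; rewrite !gt_eqF.
have [M [mM cM hA hP]] := hW X I B card_B pair_deg v_ge Ws.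
have trunc_bounds (z : R) : 0 <= z ->
    (Num.truncn z)%:R <= z /\ z < (Num.truncn z)%:R + 1.
  by move=> z0; split; [rewrite truncn_le | rewrite natr1 truncnS_gt].
have K8 : 0 < 8 * k%:R ^+ 2 :> R by lra.
have z0 : 0 <= u / (8 * k%:R ^+ 2) by rewrite divr_ge0 ?(ltW u0) ?(ltW K8).
have [cap1 cap2] := trunc_bounds _ z0.
have [l1 _] := trunc_bounds (4 * y) ltac:(lra).
have [A1 A2] := trunc_bounds (3 / 8 * u) ltac:(lra).
set cap := Num.truncn _ in cap1 cap2; set l := Num.truncn _ in l1; set A := Num.truncn _ in A1 A2.
have [M' mM' covM'] : exists2 M', matching (star B) (stars B) M' &
    forall i, inl i \in covered (star B) M'; last first.
  exact: (matching_nesting card_B pair_deg mM' covM').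
apply: (complete_matching card_B (A := A) (l := l) (cap := cap) mM).
- move=> i iM; rewrite -(ler_nat R); apply: le_trans A1 _.
  have -> : 3 / 8 * u = 3 / 8 * a * #|X|%:R by rewrite mulrA.
  apply: le_trans (hA i iM) _; rewrite ler_nat.
  rewrite -(card_imset _ (f := pair i)); last by move=> ? ? [].
  apply: subset_leq_card; apply/subsetP => -[j x] h.
  rewrite inE inl_star /= in h; case/andP: h => h /eqP E.
  by apply/imsetP; exists x; [rewrite in_set E | rewrite E].
- move=> p; rewrite truncn_ge_nat; last by lra.
  have c0 : 0 <= 5 / 4 * (#|X|%:R / Q%:R) :> R by rewrite mulr_ge0 // divr_ge0.
  have h := leftover_bound p c0 hA hP.
  have au : 0 < 3 / 8 * u by lra.
  have aE : 3 / 8 * a * #|X|%:R = 3 / 8 * u by rewrite /u mulrA.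
  rewrite -/a aE in h; rewrite -(ler_pM2r au); apply: le_trans h _.
  have -> : 4 * y * (3 / 8 * u) = 3 / 2 * (u * y) by field.
  have -> : #|X|%:R * (5 / 4 * (#|X|%:R / Q%:R)) = 5 / 4 * (u * y) by rewrite yE; field; rewrite gt_eqF.
  by apply: ler_wpM2r; [exact: ltW (mulr_gt0 u0 y0) | lra].
- move=> t ht; apply: (completion_budget (u := u) (y := y) k0 y0 yu u16 l1) => //.
  + by rewrite mulrC -ler_pdivlMr.
  (* Rounding down loses at most a factor 2, because [16 * k ^ 2 <= u]. *)
  + move: cap2; rewrite ltr_pdivrMr // => cap2.
    by lra.
  + rewrite yE; apply: (@le_trans _ _ (#|I| %/ Q)%:R).
      rewrite ler_nat; apply: leq_trans ht _; rewrite cM subKn //.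
      exact: leq_div.
    rewrite ler_pdivlMr // -natrM -natrX ler_nat.
    apply: leq_trans (leq_trunc_div _ _) _.
    exact: (blocks_le card_B lambda_gt0 pair_deg k_ge v_ge).
Qed.

End Completion.

Theorem theorem1p1 (k lambda : nat) (hk : 0 < k) (hlambda : 0 < lambda)
    (hkl : 2 * lambda + 2 <= k) :
  exists v0 : nat, forall v : nat, v0 <= v ->
    forall (X I : finType) (B : I -> {set X}),
      is_BIBD v k lambda B ->
      exists phi : I -> X, is_nesting v k lambda B phi.
Proof.
have [v0 h] := BIBD_nesting_eventually Rdefinitions.R hlambda hkl.
by exists v0 => v v0v X I B [cX cB pB]; subst v; apply: h.
Qed.
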